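(* There is a polynomial-time (many-one) reduction from the max-average constraint satisfaction problem to the feasibility problem for semidefinite programs.
   Context: Max-average constraint satisfaction problem (max-average CSP). An instance is a finite conjunction of constraints on finitely many variables, each constraint having one of the following forms: (1) $x_0 \leq \max(x_1,\dots,x_k)$ where $k \in \mathbb{N}$; (2) $x_0 \leq \frac{x_1+x_2}{2}$; (3) $x_0 = c$ where $c$ is a rational constant. (Here $x_0,x_1,\dots$ stand for arbitrary variables of the instance.) The computational task is to decide whether the conjunction has a solution over $\mathbb{Q} \cup \{-\infty\}$ (with the usual conventions for order and addition with $-\infty$). Rational constants in the input are given by numerator and denominator in binary. Feasibility problem for semidefinite programs. Given symmetric matrices $A_1,\dots,A_n,B \in \mathbb{Q}^{m\times m}$, decide whether there is $x \in \mathbb{R}^n$ such that $x_1A_1+\dots+x_nA_n-B \succeq 0$, where $S \succeq 0$ means that $S$ is symmetric positive semidefinite. The representation size of the input is the sum of the bit lengths of all rational numbers in the input. *)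

(* Defs.v *)
From Corelib Require Import BinNums.
From mathcomp Require Import all_boot all_order all_algebra.
From mathcomp Require Import reals constructive_ereal.

Set Implicit Arguments.
Unset Strict Implicit.
Unset Printing Implicit Defensive.

Import Order.TTheory GRing.Theory Num.Theory.

(** * Polynomial-time many-one reductions *)

(** A decision problem; instances are presented to machines as bit strings. *)
Record problem := Problem {
  instance : Type;
  encode : instance -> seq bool;
  encode_inj : injective encode;
  yes : instance -> Prop
}.

Inductive move := MoveLeft | Stay | MoveRight.

(** [G] is the set of work symbols; [None] is the blank and [Some (inl b)] the
    bit [b]. *)
Definition letter (G : finType) : finType := option (bool + G)%type.

(** Deterministic Turing machines with [tm_tapes.+1] two-way infinite tapes.
    Tape [ord0] is the input tape and tape [ord_max] is the output tape (they
    coincide when there is only one tape). *)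
Record tm := TM {
  tm_tapes : nat;
  tm_work : finType;
  tm_state : finType;
  tm_start : tm_state;
  tm_final : pred tm_state;
  tm_trans : tm_state -> {ffun 'I_tm_tapes.+1 -> letter tm_work} ->
             tm_state * ('I_tm_tapes.+1 -> letter tm_work * move)
}.

(** [tape_left] is listed from the head outwards, and all the cells that are
    not listed are blank. *)
Record tape (G : finType) := Tape {
  tape_left : seq (letter G);
  tape_head : letter G;
  tape_right : seq (letter G)
}.

Definition tape_move (G : finType) (d : move) (t : tape G) : tape G :=
  let: Tape l h r := t in
  match d with
  | MoveLeft => Tape (behead l) (head None l) (h :: r)
  | Stay => t
  | MoveRight => Tape (h :: l) (head None r) (behead r)
  end.

Definition tape_write (G : finType) (a : letter G) (t : tape G) : tape G :=
  Tape (tape_left t) a (tape_right t).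

(** The tape on which [w] is written, with the head on its first letter. *)
Definition tape_of (G : finType) (w : seq bool) : tape G :=
  let s := [seq Some (inl b) | b <- w] in Tape [::] (head None s) (behead s).

Fixpoint bit_prefix (G : finType) (s : seq (letter G)) : seq bool :=
  if s is Some (inl b) :: s' then b :: bit_prefix s' else [::].

(** The longest bit string that can be read from the head rightwards. *)
Definition tape_contents (G : finType) (t : tape G) : seq bool :=
  bit_prefix (tape_head t :: tape_right t).

Record config (M : tm) := Config {
  cfg_state : tm_state M;
  cfg_tapes : 'I_(tm_tapes M).+1 -> tape (tm_work M)
}.

Definition tm_init (M : tm) (w : seq bool) : config M :=
  Config (tm_start M)
    (fun i => tape_of (tm_work M) (if i == ord0 then w else [::])).

(** Each head writes and then moves; final configurations do not change. *)
Definition tm_step (M : tm) (c : config M) : config M :=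
  if tm_final (cfg_state c) then c else
  let: (q, act) :=
    tm_trans (cfg_state c) [ffun i => tape_head (cfg_tapes c i)] in
  Config q
    (fun i => tape_move (act i).2 (tape_write (act i).1 (cfg_tapes c i))).

(** On input [w], [M] halts within [t] steps with output [v]. *)
Definition tm_outputs_within (M : tm) (w v : seq bool) (t : nat) : Prop :=
  let c := iter t (@tm_step M) (tm_init M w) in
  tm_final (cfg_state c) /\ tape_contents (cfg_tapes c ord_max) = v.

Definition polytime_computable (P Q : problem) (f : instance P -> instance Q)
    : Prop :=
  exists (M : tm) (p : {poly nat}), forall x : instance P,
    tm_outputs_within M (encode x) (encode (f x)) p.[size (encode x)]%R.

Definition polytime_reducible (P Q : problem) : Prop :=
  exists f : instance P -> instance Q,
    polytime_computable f /\ forall x : instance P, yes x <-> yes (f x).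

(** * Encodings *)

Definition prefix_code (T : Type) (e : T -> seq bool) : Prop :=
  forall x y s t, e x ++ s = e y ++ t -> x = y /\ s = t.

Lemma prefix_code_inj (T : Type) (e : T -> seq bool) :
  prefix_code e -> injective e.
Proof. by move=> eP x y exy; case: (eP x y [::] [::]); rewrite // exy. Qed.

Definition enc_bool (b : bool) : seq bool := [:: b].

Definition enc_seq (T : Type) (e : T -> seq bool) (s : seq T) : seq bool :=
  flatten [seq true :: e x | x <- s] ++ [:: false].

Definition enc_unary (n : nat) : seq bool := rcons (nseq n true) false.

(** Binary digits, least significant first; [0] has none. *)
Fixpoint bits_of_pos (p : positive) : seq bool :=
  match p with
  | xH => [:: true]
  | xO p' => false :: bits_of_pos p'
  | xI p' => true :: bits_of_pos p'
  end.

Definition bits_of_nat (n : nat) : seq bool :=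
  if bin_of_nat n is Npos p then bits_of_pos p else [::].

(** The bit string is made self-delimiting, which about doubles its length. *)
Definition enc_nat (n : nat) : seq bool := enc_seq enc_bool (bits_of_nat n).

Definition enc_int (z : int) : seq bool :=
  enc_bool (z < 0)%R ++ enc_nat `|z|%N.

(** Numerator and denominator in lowest terms. *)
Definition enc_rat (c : rat) : seq bool :=
  enc_int (numq c) ++ enc_nat `|denq c|%N.

Definition enc_ord (n : nat) (i : 'I_n) : seq bool := enc_unary i.

(** A matrix is written as the list of its rows. *)
Definition mx_rows (T : Type) (m n : nat) (A : 'M[T]_(m, n)) : seq (seq T) :=
  [seq [seq A i j | j <- enum 'I_n] | i <- enum 'I_m].

Definition enc_rows : seq (seq rat) -> seq bool := enc_seq (enc_seq enc_rat).

Lemma cat_prefix (T U : Type) (e : T -> seq bool) (f : U -> seq bool) :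
  prefix_code e -> prefix_code f -> forall x y x' y' s t,
  (e x ++ f y) ++ s = (e x' ++ f y') ++ t -> [/\ x = x', y = y' & s = t].
Proof.
move=> eP fP x y x' y' s t; rewrite -2!catA => /eP[-> /fP[-> ->]].
by split.
Qed.

Lemma enc_bool_prefix : prefix_code enc_bool.
Proof. by move=> x y s t [-> ->]. Qed.

Lemma enc_seq_prefix (T : Type) (e : T -> seq bool) :
  prefix_code e -> prefix_code (enc_seq e).
Proof.
move=> eP; elim=> [|x s IHs] [|y t] u v //=; first by case=> ->.
rewrite /enc_seq /= -!catA => -[] /eP[<- eq_st].
by case: (IHs t u v); rewrite /enc_seq -?catA // => -> ->.
Qed.

Lemma enc_unary_prefix : prefix_code enc_unary.
Proof.
elim=> [|m IHm] [|n] s t //=; first by case=> ->.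
by rewrite /enc_unary /= => -[] /IHm[-> ->].
Qed.

Lemma bits_of_pos_inj : injective bits_of_pos.
Proof.
have bits_nil p : bits_of_pos p <> [::] by case: p.
elim=> [p IHp|p IHp|] [q|q|] //= => [[/IHp->]|[/bits_nil]|[/IHp->]|] //.
by case=> /esym/bits_nil.
Qed.

Lemma bits_of_nat_inj : injective bits_of_nat.
Proof.
move=> m n; rewrite /bits_of_nat => eq_mn; apply: (can_inj bin_of_natK).
case: (bin_of_nat m) (bin_of_nat n) eq_mn => [|p] [|q] //=; first by case: q.
- by case: p.
- by move/bits_of_pos_inj->.
Qed.

Lemma enc_nat_prefix : prefix_code enc_nat.
Proof.
by move=> m n s t /(enc_seq_prefix enc_bool_prefix)[/bits_of_nat_inj-> ->].
Qed.

Lemma enc_int_prefix : prefix_code enc_int.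
Proof.
move=> x y s t /(cat_prefix enc_bool_prefix enc_nat_prefix)[sgn_xy abs_xy ->].
split=> //; rewrite (intEsign x) (intEsign y); congr (_ * _)%R.
  by rewrite sgn_xy.
by rewrite abs_xy.
Qed.

Lemma enc_rat_prefix : prefix_code enc_rat.
Proof.
move=> x y s t /(cat_prefix enc_int_prefix enc_nat_prefix)[num_xy den_xy ->].
split=> //; rewrite -(divq_num_den x) -(divq_num_den y) num_xy; congr (_ / _)%R.
by rewrite -(absz_denq x) -(absz_denq y) den_xy.
Qed.

Lemma enc_ord_prefix (n : nat) : prefix_code (@enc_ord n).
Proof. by move=> i j s t /enc_unary_prefix[/val_inj-> ->]. Qed.

Lemma enc_rows_prefix : prefix_code enc_rows.
Proof. by do 2!apply: enc_seq_prefix; apply: enc_rat_prefix. Qed.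

Lemma mx_rows_inj (T : Type) (m n : nat) : injective (@mx_rows T m n).
Proof.
move=> A B /eq_in_map eqAB; apply/matrixP=> i j.
by have /eq_in_map-> := eqAB i (mem_enum _ _); rewrite ?mem_enum.
Qed.

(** * Max-average constraints *)

Inductive constraint (n : nat) :=
  | LeMax (x0 : 'I_n) (xs : seq 'I_n)
  | LeAverage (x0 x1 x2 : 'I_n)
  | EqConst (x0 : 'I_n) (c : rat).

Record max_average := MaxAverage {
  ma_vars : nat;
  ma_constraints : seq (constraint ma_vars)
}.

(** The maximum of no variables is [-oo]. *)
Definition satisfies (n : nat) (x : 'I_n -> \bar rat) (C : constraint n)
    : Prop :=
  match C with
  | LeMax x0 xs => (x x0 <= \big[maxe/-oo]_(i <- xs) x i)%E
  | LeAverage x0 x1 x2 => (x x0 <= (x x1 + x x2) * (2^-1%R)%:E)%E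
  | EqConst x0 c => x x0 = c%:E
  end.

(** Solutions take values in the rationals extended with [-oo] only. *)
Definition ma_solvable (I : max_average) : Prop :=
  exists x : 'I_(ma_vars I) -> \bar rat,
    (forall i, x i != +oo%E) /\
    foldr and True [seq satisfies x C | C <- ma_constraints I].

Definition enc_constraint (n : nat) (C : constraint n) : seq bool :=
  match C with
  | LeMax x0 xs => [:: true] ++ enc_ord x0 ++ enc_seq (@enc_ord n) xs
  | LeAverage x0 x1 x2 =>
      [:: false; true] ++ enc_ord x0 ++ enc_ord x1 ++ enc_ord x2
  | EqConst x0 c => [:: false; false] ++ enc_ord x0 ++ enc_rat c
  end.

(** The [n] variables are part of the instance, which therefore has size at
    least [n]: writing variables in unary rather than in binary changes the
    size by at most a polynomial. Constants are written in binary. *)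
Definition enc_max_average (I : max_average) : seq bool :=
  enc_unary (ma_vars I) ++ enc_seq (@enc_constraint _) (ma_constraints I).

Lemma enc_constraint_prefix (n : nat) : prefix_code (@enc_constraint n).
Proof.
have oP := @enc_ord_prefix n.
have oP2 := cat_prefix oP oP.
move=> [x xs|x x1 x2|x c] [y ys|y y1 y2|y d] s t //=; case.
- by move=> /(cat_prefix oP (enc_seq_prefix oP))[-> -> ->].
- rewrite -(catA (enc_ord x)) -(catA (enc_ord y)).
  by move=> /oP[-> /oP2[-> -> ->]].
- by move=> /(cat_prefix oP enc_rat_prefix)[-> -> ->].
Qed.

Lemma enc_max_average_inj : injective enc_max_average.
Proof.
move=> [n s] [m t]; rewrite /enc_max_average /=.
case/enc_unary_prefix=> eq_nm; case: m / eq_nm t => t.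
by move/(prefix_code_inj (enc_seq_prefix (@enc_constraint_prefix n)))->.
Qed.

Definition max_average_csp : problem :=
  Problem enc_max_average_inj ma_solvable.

(** * Feasibility of semidefinite programs *)

Record sdp := SDP {
  sdp_dim : nat;
  sdp_vars : nat;
  sdp_A : {ffun 'I_sdp_vars -> 'M[rat]_sdp_dim};
  sdp_B : 'M[rat]_sdp_dim;
  sdp_sym : [forall i, (sdp_A i)^T == sdp_A i]%R && (sdp_B^T == sdp_B)%R
}.

Definition psd (R : realType) (m : nat) (S : 'M[R]_m) : Prop :=
  (S^T = S /\ forall v : 'cV[R]_m, 0 <= (v^T *m S *m v) 0 0)%R.

Definition sdp_feasible (R : realType) (I : sdp) : Prop :=
  exists x : 'I_(sdp_vars I) -> R,
    psd (\sum_i x i *: map_mx ratr (sdp_A I i) - map_mx ratr (sdp_B I))%R.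

Definition enc_sdp (I : sdp) : seq bool :=
  enc_rows (mx_rows (sdp_B I)) ++
  enc_seq enc_rows [seq mx_rows (sdp_A I i) | i <- enum 'I_(sdp_vars I)].

Lemma enc_sdp_inj : injective enc_sdp.
Proof.
move=> [m n A B symAB] [m' n' A' B' symAB']; rewrite /enc_sdp /=.
case/enc_rows_prefix=> eqB /(prefix_code_inj (enc_seq_prefix enc_rows_prefix)).
have size_map_ord k T (f : 'I_k -> T) : size [seq f i | i <- enum 'I_k] = k.
  by rewrite size_map size_enum_ord.
have eq_m : m = m' by have := congr1 size eqB; rewrite !size_map_ord.
case: m' / eq_m A' B' symAB' eqB => A' B' symAB' /mx_rows_inj eqB eqA.
have eq_n : n = n' by have := congr1 size eqA; rewrite !size_map_ord.
case: n' / eq_n A' symAB' eqA => A' symAB' /eq_in_map eqA.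
have eqAA' : A = A'.
  by apply/ffunP=> i; apply: mx_rows_inj; apply: eqA; rewrite mem_enum.
case: B' / eqB symAB' => symAB'; case: A' / eqAA' {eqA} symAB' => symAB'.
by congr SDP; apply: eq_irrelevance.
Qed.

Definition sdp_feasibility (R : realType) : problem :=
  Problem enc_sdp_inj (sdp_feasible R).

(* Main.v *)
Require Import Defs.
From HB Require Import structures.
From mathcomp Require Import all_boot all_order all_algebra perm.
From mathcomp Require Import reals boolp constructive_ereal sequences exp.
From mathcomp Require Import zify ring lra.

Set Implicit Arguments.
Unset Strict Implicit.
Unset Printing Implicit Defensive.
Import Order.TTheory GRing.Theory Num.Theory.

(** The idea is to exponentiate. A value [x] of a max-average problem becomes the
    positive real 2^(E x - H), for a huge unit [E] and an offset [H], and -oo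
    becomes 0. An average constraint then reads y0^2 <= y1 y2 and says that a 2x2
    matrix is positive semidefinite; a maximum is replaced by the linear
    constraint y0 <= y1 + ... + yk. The latter is too weak, but only just: it
    gives x0 <= max (x1, ..., xk) + log2 k / E.

    Such an error does no harm. Choose for each maximum an entry which dominates
    the left-hand side up to the error. What remains is a linear system with
    integer coefficients, in which the error is one more unknown, and the system
    has a solution with a small error. Among its solutions with no larger error
    there is one at which the tight rows span all the rows, and Cramer's rule
    then provides one with fractional entries whose common denominator is a
    minor, hence is at most the product of the l1 norms of the rows. An error
    smaller than the inverse of this product vanishes ([lp_rounding]). The norm of
    the row of a constraint is at most exponential in half the length of its
    code ([weight_le_size]), so that a unit of about 2^(N/2), for instances of
    length [N], is large enough ([total_bound]).

    As to constants, a 2x2 block bounds a variable from above by the geometric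
    mean of two others, that is, its level by the mean of theirs. Repeated squaring yields a variable
    [Zero] that equals 2^-H with H = 2^(N-1), the level 0, and reference
    variables which are at most the levels E 2^k and - E 2^k
    ([common_bounds]). Horner's scheme from the least significant digit is a
    succession of means, one for each binary digit. To
    obtain x = p / q, run it through the digits of [p]: this produces the bound
    p E. Continued through the digits of 2^k - q, with [x] itself as the
    reference, it yields 2^k x <= p + (2^k - q) x, that is q x <= p; run through
    the digits of [p] with the opposite reference and then through those of [q],
    it yields 0 <= - p + q x ([constant_elim], [constant_intro]).

    The reduction can be computed by sweeping over the instance with a finite
    memory, since all this is organised along the word that encodes it. There
    is one variable for each position of the word and each of 14 slots, and the
    letter at a position, together with the state of a finite automaton which
    parses the word, determines constraints on the variables at this position
    and at the preceding one. The only other variables that occur are those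
    whose index is the number of letters read in the current unary number or
    numerator; they are found by marks which advance by one cell when the index
    of the variable increases. The machine prints one row of a matrix per
    sweep ([passes], [printer]). *)

(** * Turing machines that sweep over their input *)

(** A machine that sweeps over a word: in control state [c] it acts as a Mealy
    machine which rewrites each cell and appends bits to the output, and its
    memory at the end of the sweep determines the next control state. *)
Record passes := Passes {
  pass_ctrl : finType;
  pass_mem : finType;
  pass_sym : finType;
  pass_start : pass_ctrl;
  pass_done : pred pass_ctrl;
  pass_mem0 : pass_mem;
  pass_scan : pass_ctrl -> pass_mem -> bool + pass_sym ->
              pass_mem * (bool + pass_sym) * seq bool;
  pass_next : pass_ctrl -> pass_mem -> pass_ctrl * seq bool
}.

Section PassMachine.

Variable P : passes.

Local Notation C := (pass_ctrl P).
Local Notation Q := (pass_mem P).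
Local Notation cell := (bool + pass_sym P)%type.

Implicit Types (c : C) (q : Q) (x : cell) (s : seq cell) (o e w : seq bool).

Fixpoint pass_run (c : C) (q : Q) (s : seq cell) : Q * seq cell * seq bool :=
  if s is x :: s' then
    let: (q1, x1, e1) := pass_scan c q x in
    let: (q2, s2, e2) := pass_run c q1 s' in
    (q2, x1 :: s2, e1 ++ e2)
  else (q, [::], [::]).

Definition pass_config := (C * seq cell * seq bool)%type.

Definition pass_step (k : pass_config) : pass_config :=
  let: (c, s, o) := k in
  if pass_done c then k else
  let: (q, s', e) := pass_run c (pass_mem0 P) s in
  let: (c', e') := pass_next c q in
  (c', s', o ++ e ++ e').

Arguments pass_step : simpl never.

(** The bits that remain to be emitted, one at each step, belong to the state of
    the machine; this bound makes the set of states finite. *)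
Definition emit_bound : nat :=
  maxn (\max_(x : C * Q * cell) size (@pass_scan P x.1.1 x.1.2 x.2).2)
       (\max_(x : C * Q) size (@pass_next P x.1 x.2).2).

Local Notation K := emit_bound.
Local Notation pending := {bseq K of bool}.

Lemma size_pass_scan c q x : size (pass_scan c q x).2 <= K.
Proof.
rewrite leq_max; apply/orP; left.
pose F (y : C * Q * cell) := size (pass_scan y.1.1 y.1.2 y.2).2.
exact: (@leq_bigmax _ F (c, q, x)).
Qed.

Lemma size_pass_next c q : size (pass_next c q).2 <= K.
Proof.
rewrite leq_max; apply/orP; right.
pose F (y : C * Q) := size (pass_next y.1 y.2).2.
exact: (@leq_bigmax _ F (c, q)).
Qed.

(** [Return c] brings the head back to the first cell before the sweep [c].
    [Leave] and [Rewind] do the same on the output tape before halting. *)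
Inductive phase := Scan of C & Q | Return of C | Leave | Rewind | Halted.

Definition phase_code (ph : phase) : (C * Q) + (C + option bool) :=
  match ph with
  | Scan c q => inl (c, q)
  | Return c => inr (inl c)
  | Leave => inr (inr (Some false))
  | Rewind => inr (inr (Some true))
  | Halted => inr (inr None)
  end.

Definition phase_decode (x : (C * Q) + (C + option bool)) : phase :=
  match x with
  | inl (c, q) => Scan c q
  | inr (inl c) => Return c
  | inr (inr (Some false)) => Leave
  | inr (inr (Some true)) => Rewind
  | inr (inr None) => Halted
  end.

Lemma phase_codeK : cancel phase_code phase_decode.
Proof. by case. Qed.

HB.instance Definition _ := Finite.copy phase (can_type phase_codeK).

Definition pass_state : finType := (pending * phase)%type.
Definition pend (e : seq bool) : pending := insub_bseq K e.

Local Notation sym := (letter (pass_sym P)).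

Definition pass_act (st : pass_state) (h0 h1 : sym) :
    pass_state * ((sym * move) * (sym * move)) :=
  let: (e, ph) := st in
  if (e : seq bool) is b :: e' then
    ((pend e', ph), ((h0, Stay), (Some (inl b), MoveRight)))
  else match ph with
  | Scan c q =>
      if h0 is Some x then
        let: (q', x', e') := pass_scan c q x in
        ((pend e', Scan c q'), ((Some x', MoveRight), (h1, Stay)))
      else
        let: (c', e') := pass_next c q in
        ((pend e', if pass_done c' then Leave else Return c'),
         ((None, MoveLeft), (h1, Stay)))
  | Return c =>
      if h0 is None
      then ((pend [::], Scan c (pass_mem0 P)), ((h0, MoveRight), (h1, Stay)))
      else (st, ((h0, MoveLeft), (h1, Stay)))
  | Leave => ((pend [::], Rewind), ((h0, Stay), (h1, MoveLeft)))
  | Rewind =>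
      if h1 is None
      then ((pend [::], Halted), ((h0, Stay), (h1, MoveRight)))
      else (st, ((h0, Stay), (h1, MoveLeft)))
  | Halted => (st, ((h0, Stay), (h1, Stay)))
  end.

Definition pass_tm : tm :=
  @TM 1 (pass_sym P) pass_state (pend [::], Scan (pass_start P) (pass_mem0 P))
    [pred st : pass_state | st.2 == Halted]
    (fun st h => let: (st', (a0, a1)) := pass_act st (h ord0) (h ord_max) in
       (st', fun i => if i == ord0 then a0 else a1)).

Local Notation tp := (tape (pass_sym P)).

Definition conf (st : pass_state) (t0 t1 : tp) : config pass_tm :=
  @Config pass_tm st (fun i => if i == ord0 then t0 else t1).

Definition act_on (a : sym * move) (t : tp) : tp :=
  tape_move a.2 (tape_write a.1 t).

Lemma conf_step st t0 t1 : st.2 != Halted ->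
  tm_step (conf st t0 t1) =
    let: (st', (a0, a1)) := pass_act st (tape_head t0) (tape_head t1) in
    conf st' (act_on a0 t0) (act_on a1 t1).
Proof.
move=> nh; rewrite /tm_step /= (negPf nh) !ffunE /=.
case: (pass_act _ _ _) => [st' [a0 a1]]; congr Config; apply: funext => i.
by case: (i == ord0).
Qed.

Definition within (b : nat) (k k' : config pass_tm) : Prop :=
  exists2 n, n <= b & iter n (@tm_step pass_tm) k = k'.

Lemma within_trans b1 b2 k1 k2 k3 :
  within b1 k1 k2 -> within b2 k2 k3 -> within (b1 + b2) k1 k3.
Proof.
move=> [n1 le1 <-] [n2 le2 <-]; exists (n2 + n1); last by rewrite iterD.
by rewrite addnC leq_add.
Qed.

Lemma within_leq b1 b2 k k' : b1 <= b2 -> within b1 k k' -> within b2 k k'.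
Proof. by move=> le12 [n le1 <-]; exists n => //; apply: leq_trans le12. Qed.

Lemma within0 k : within 0 k k.
Proof. by exists 0. Qed.

Lemma within_step b st t0 t1 k' : st.2 != Halted ->
  (let: (st', (a0, a1)) := pass_act st (tape_head t0) (tape_head t1) in
   within b (conf st' (act_on a0 t0) (act_on a1 t1)) k') ->
  within b.+1 (conf st t0 t1) k'.
Proof.
move=> nh; have := conf_step t0 t1 nh.
case: (pass_act _ _ _) => [st' [a0 a1]] step1 step2; rewrite -[b.+1]add1n.
by apply: within_trans step2; exists 1.
Qed.

(** An empty [s] stands for a head that scans a blank with blanks beyond. *)
Definition zip_tape (l s : seq sym) : tp := Tape l (head None s) (behead s).

Definition out_tape (o : seq bool) : tp :=
  zip_tape (rev [seq Some (inl b) | b <- o]) [::].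

Lemma pendK e : size e <= K -> pend e = e :> seq bool.
Proof. by move=> le_eK; rewrite /pend /insub_bseq val_insubd le_eK. Qed.

Arguments zip_tape : simpl never.
Arguments out_tape : simpl never.

Lemma act_right y l a (s : seq sym) :
  act_on (y, MoveRight) (zip_tape l (a :: s)) = zip_tape (y :: l) s.
Proof. by []. Qed.

Lemma act_stay t : act_on (tape_head t, Stay) t = t.
Proof. by case: t. Qed.

Lemma act_idle o : act_on (None, Stay) (out_tape o) = out_tape o.
Proof. by []. Qed.

Lemma act_emit o b :
  act_on (Some (inl b), MoveRight) (out_tape o) = out_tape (rcons o b).
Proof. by rewrite /out_tape map_rcons rev_rcons. Qed.

Arguments act_on : simpl never.

Lemma emit_run e ph t0 o : size e <= K -> ph != Halted ->
  within (size e) (conf (pend e, ph) t0 (out_tape o))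
    (conf (pend [::], ph) t0 (out_tape (o ++ e))).
Proof.
move=> + nh; elim: e o => [|b e IHe] o le_eK; first by rewrite cats0; exists 0.
have le_eK' : size e <= K by apply: ltnW.
apply: within_step => //=; rewrite pendK //= act_stay act_emit -cat_rcons.
exact: IHe.
Qed.

Definition cells (s : seq cell) : seq sym := [seq Some x | x <- s].

Lemma scan_run c q s l j o :
  let: (q', s', e) := pass_run c q s in
  within (size s * K.+1)
    (conf (pend [::], Scan c q) (zip_tape l (cells s ++ nseq j None))
       (out_tape o))
    (conf (pend [::], Scan c q')
       (zip_tape (rev (cells s') ++ l) (nseq j None)) (out_tape (o ++ e))).
Proof.
elim: s q l o => [|x s IHs] q l o /=; first by rewrite cats0; apply: within0.
have := size_pass_scan c q x.
case E: (pass_scan c q x) => [[q1 x1] e1] /= le1.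
move: (IHs q1 (Some x1 :: l) (o ++ e1)).
case: (pass_run c q1 s) => [[q2 s2] e2] run2.
rewrite mulSn addSn; apply: within_step => //=; rewrite pendK //= E.
rewrite act_idle act_right; apply: within_trans.
  by apply: (within_leq le1); apply: emit_run.
by rewrite catA rev_cons cat_rcons.
Qed.

Lemma return_run c s i r t1 :
  within (size s).+1
    (conf (pend [::], Return c)
       (Tape (behead (cells s ++ nseq i None))
             (head None (cells s ++ nseq i None)) r) t1)
    (conf (pend [::], Scan c (pass_mem0 P))
       (zip_tape (None :: nseq i.-1 None) (rev (cells s) ++ r)) t1).
Proof.
elim: s r => [|x s IHs] r /=.
  apply: within_step => //=; rewrite pendK //=.
  have -> : head None (nseq i None) = None :> sym by case: i.
  rewrite act_stay /act_on; case: i => [|i]; exact (within0 _).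
apply: within_step => //=; rewrite pendK //= rev_cons cat_rcons act_stay.
exact: IHs.
Qed.

Lemma size_pass_run c q s :
  size (pass_run c q s).1.2 = size s /\
  size (pass_run c q s).2 <= size s * K.
Proof.
elim: s q => [|x s IHs] q //=; have := size_pass_scan c q x.
case: (pass_scan c q x) => [[q1 x1] e1] /= le1; move: (IHs q1).
case: (pass_run c q1 s) => [[q2 s2] e2] /= [-> le2].
by rewrite size_cat mulSn leq_add.
Qed.

Definition pass_time (n : nat) : nat := n * K.+1 + (K + n).+2.

(** The head steps onto a blank at either end of the word, and a blank that has
    been visited is listed on the tape: hence the unspecified numbers of
    blanks around the word before and after the sweep. *)
Lemma pass_step_run c s o i j : ~~ pass_done c ->
  let: (c', s', o') := pass_step (c, s, o) in
  if pass_done c' then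
    exists t0, within (pass_time (size s))
      (conf (pend [::], Scan c (pass_mem0 P))
         (zip_tape (nseq i None) (cells s ++ nseq j None)) (out_tape o))
      (conf (pend [::], Leave) t0 (out_tape o'))
  else
    exists i' j', within (pass_time (size s))
      (conf (pend [::], Scan c (pass_mem0 P))
         (zip_tape (nseq i None) (cells s ++ nseq j None)) (out_tape o))
      (conf (pend [::], Scan c' (pass_mem0 P))
         (zip_tape (nseq i' None) (cells s' ++ nseq j' None)) (out_tape o')).
Proof.
move=> ncd; rewrite /pass_step (negPf ncd).
have := scan_run c (pass_mem0 P) s (nseq i None) j o.
have [szs' _] := size_pass_run c (pass_mem0 P) s.
case: (pass_run c (pass_mem0 P) s) szs' => [[q s'] e] /= szs' run1.
have := size_pass_next c q; case E: (pass_next c q) => [c' e'] /= le_e'.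
set L := rev (cells s') ++ nseq i None in run1.
pose R : seq sym := None :: behead (nseq j None).
have R_nseq : R = nseq (j.-1).+1 None by rewrite /R; case: (j).
pose ph := if pass_done c' then Leave else Return c'.
have run3 := emit_run (e := e') (ph := ph) (Tape (behead L) (head None L) R)
  (o ++ e) le_e'.
have {}run3 : within (K.+1 + size s * K.+1)
    (conf (pend [::], Scan c (pass_mem0 P))
         (zip_tape (nseq i None) (cells s ++ nseq j None)) (out_tape o))
    (conf (pend [::], ph) (Tape (behead L) (head None L) R)
         (out_tape (o ++ e ++ e'))).
  rewrite addnC; apply: (within_trans run1); rewrite -add1n catA.
  apply: within_trans; last first.
    by apply: (within_leq le_e'); apply: run3; rewrite /ph; case: ifP.
  exists 1 => //=; rewrite conf_step //= pendK //=.
  have -> : head None (nseq j None) = None :> sym by case: (j).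
  by rewrite E act_idle.
rewrite /ph in run3; case: (pass_done c') run3 => run3.
  exists (Tape (behead L) (head None L) R); apply: within_leq run3.
  by rewrite /pass_time addnC leq_add2l ltnS -addnS leq_addr.
exists (i.-1).+1, (j.-1).+1; apply: within_leq (within_trans run3 _); last first.
  rewrite /L -map_rev.
  have := return_run c' (rev s') i R (out_tape (o ++ e ++ e')).
  by rewrite {3}/cells -(map_rev Some (rev s')) revK R_nseq; exact.
by rewrite size_rev szs' /pass_time; lia.
Qed.

Lemma rewind_run (s : seq bool) r t0 :
  within (size s).+1
    (conf (pend [::], Rewind) t0
      (Tape (behead [seq Some (inl b) | b <- s])
         (head None [seq Some (inl b) | b <- s]) r))
    (conf (pend [::], Halted) t0
      (zip_tape [:: None] ([seq Some (inl b) | b <- rev s] ++ r))).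
Proof.
elim: s r => [|b s IHs] r /=.
  by apply: within_step => //=; rewrite pendK //= act_stay; exact: within0.
apply: within_step => //=; rewrite pendK //= rev_cons map_rcons cat_rcons act_stay.
exact: IHs.
Qed.

Lemma bit_prefix_bits (G : finType) (o : seq bool) (r : seq (letter G)) :
  bit_prefix ([seq Some (inl b) | b <- o] ++ None :: r) = o.
Proof. by elim: o => //= b o ->. Qed.

Lemma leave_run t0 o : exists t0' t1,
  within (size o + 2)
    (conf (pend [::], Leave) t0 (out_tape o)) (conf (pend [::], Halted) t0' t1)
  /\ tape_contents t1 = o.
Proof.
exists t0, (zip_tape [:: None] ([seq Some (inl b) | b <- o] ++ [:: None])).
split.
  rewrite addn2; apply: within_step => //=; rewrite pendK //= /act_on /=.
  have := rewind_run (rev o) [:: None] t0.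
  by rewrite size_rev revK map_rev; case: t0.
have := @bit_prefix_bits (pass_sym P) o [::].
by rewrite /tape_contents; case: o.
Qed.

Lemma pass_step_sizes n c s o :
  let: (c', s', o') := iter n pass_step (c, s, o) in
  size s' = size s /\ size o' <= size o + n * ((size s).+1 * K).
Proof.
elim: n => [|n IHn] /=; first by rewrite addn0.
case: (iter n _ _) IHn => [[c1 s1] o1] [sz1 le1]; rewrite /pass_step.
case: ifP => _.
  by split=> //; apply: leq_trans le1 _; rewrite leq_add2l mulSn leq_addl.
have := size_pass_run c1 (pass_mem0 P) s1.
case: (pass_run c1 (pass_mem0 P) s1) => [[q s2] e] /= [sz2 le_e].
have := size_pass_next c1 q; case: (pass_next c1 q) => [c' e'] /= le_e'.
split; first by rewrite sz2.
rewrite !size_cat; apply: leq_trans (leq_add le1 (leq_add le_e le_e')) _.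
by rewrite sz1; lia.
Qed.

Lemma iter_done n k : pass_done k.1.1 -> iter n pass_step k = k.
Proof.
case: k => [[c s] o] /= d; elim: n => //= n ->.
by rewrite /pass_step d.
Qed.

Lemma passes_run n c s o i j : ~~ pass_done c ->
  let: (c', s', o') := iter n pass_step (c, s, o) in
  pass_done c' ->
  exists t0, within (n * pass_time (size s))
      (conf (pend [::], Scan c (pass_mem0 P))
         (zip_tape (nseq i None) (cells s ++ nseq j None)) (out_tape o))
      (conf (pend [::], Leave) t0 (out_tape o')).
Proof.
elim: n c s o i j => [|n IHn] c s o i j ncd; first by rewrite /= (negPf ncd).
have := pass_step_run s o i j ncd; have /= := pass_step_sizes 1 c s o.
rewrite -iterS iterSr; case E: (pass_step (c, s, o)) => [[c1 s1] o1] [sz1 _].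
case: ifP => [d|/negbT nd].
  rewrite iter_done // => -[t0 run1] _; exists t0.
  by apply: within_leq run1; rewrite mulSn leq_addr.
case=> i1 [j1 run1]; move: (IHn c1 s1 o1 i1 j1 nd).
case: (iter n _ _) => [[c' s'] o'] run2 d; case: (run2 d) => t0 {}run2.
by exists t0; rewrite mulSn; apply: (within_trans run1); rewrite -sz1.
Qed.

(** Each sweep crosses the word twice, and emits at most [emit_bound] bits per
    cell and as many at the end. The second summand is for the return of the
    output head. *)
Lemma pass_tm_outputs n w v :
  (let: (c, s, o) := iter n pass_step (pass_start P, [seq inl b | b <- w], [::])
   in pass_done c /\ o = v) ->
  ~~ pass_done (pass_start P) ->
  tm_outputs_within pass_tm w v
    (n * pass_time (size w) + (n * ((size w).+1 * K) + 2)).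
Proof.
move=> runs nd; have := passes_run n [seq inl b | b <- w] [::] 0 0 nd.
have := pass_step_sizes n (pass_start P) [seq inl b | b <- w] [::].
case: (iter n _ _) runs => [[c s] o] [d <-] [_]; rewrite !size_map add0n.
move=> le_o /(_ d)[t0 run1]; have [t0' [t1 [run2 out_t1]]] := leave_run t0 o.
have run3 : within (n * pass_time (size w) + (n * ((size w).+1 * K) + 2))
    (tm_init pass_tm w) (conf (pend [::], Halted) t0' t1).
  apply: within_leq (within_trans _ run2); last first.
    have -> : tm_init pass_tm w = conf (pend [::], Scan (pass_start P)
        (pass_mem0 P)) (zip_tape (nseq 0 None) (cells [seq inl b | b <- w] ++
          nseq 0 None)) (out_tape [::]).
      rewrite /tm_init /conf /=; congr Config; apply: funext => i.
      rewrite cats0 /cells -map_comp /tape_of /=.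
      by case: (i == ord0).
    exact: run1.
  by rewrite leq_add2l leq_add2r.
case: run3 => m le_m run3.
rewrite /tm_outputs_within -(subnK le_m) iterD run3.
suff -> : iter (n * pass_time (size w) + (n * ((size w).+1 * K) + 2) - m)
   (@tm_step pass_tm) (conf (pend [::], Halted) t0' t1) =
   conf (pend [::], Halted) t0' t1 by [].
by elim: (_ - m) => //= k ->; rewrite /tm_step.
Qed.

End PassMachine.

(** * Reading an instance, and the constraints attached to its letters *)

(** Instances are read by a finite automaton. In a fraction each digit comes
    after a flag: [PNum s] expects the flag and [PNumBit s] the digit, for a
    numerator of sign [s]. [PDen seen] and [PDenBit seen] do the same in the
    denominator, where [seen] tells whether a digit 1 has been read, as the
    two's complement of the denominator is formed on the fly. *)
Inductive pstate :=
  | PStart | PVars | PList | PTag | PTag2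
  | PMaxLhs | PMaxList | PMaxItem
  | PAvgLhs | PAvgFst | PAvgSnd
  | PCstVar | PSign | PNum of bool | PNumBit of bool
  | PDen of bool | PDenBit of bool | PDone.

Definition pstate_code (q : pstate) : nat :=
  match q with
  | PStart => 0 | PVars => 1 | PList => 2 | PTag => 3 | PTag2 => 4
  | PMaxLhs => 5 | PMaxList => 6 | PMaxItem => 7
  | PAvgLhs => 8 | PAvgFst => 9 | PAvgSnd => 10
  | PCstVar => 11 | PSign => 12 | PNum b => 13 + b | PNumBit b => 15 + b
  | PDen b => 17 + b | PDenBit b => 19 + b | PDone => 21
  end.

Definition pstates : seq pstate :=
  [:: PStart; PVars; PList; PTag; PTag2; PMaxLhs; PMaxList; PMaxItem;
      PAvgLhs; PAvgFst; PAvgSnd; PCstVar; PSign; PNum false; PNum true;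
      PNumBit false; PNumBit true; PDen false; PDen true;
      PDenBit false; PDenBit true; PDone].

Lemma pstate_codeK : cancel pstate_code (nth PStart pstates).
Proof. by do 2?case. Qed.

HB.instance Definition _ := Countable.copy pstate (can_type pstate_codeK).

Lemma pstates_enum : Finite.axiom pstates.
Proof. by do 2?case. Qed.

HB.instance Definition _ := isFinite.Build pstate pstates_enum.

Definition pnext (q : pstate) (b : bool) : pstate :=
  match q with
  | PStart | PVars => if b then PVars else PList
  | PList => if b then PTag else PDone
  | PTag => if b then PMaxLhs else PTag2
  | PTag2 => if b then PAvgLhs else PCstVar
  | PMaxLhs => if b then PMaxLhs else PMaxList
  | PMaxList => if b then PMaxItem else PList
  | PMaxItem => if b then PMaxItem else PMaxList
  | PAvgLhs => if b then PAvgLhs else PAvgFst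
  | PAvgFst => if b then PAvgFst else PAvgSnd
  | PAvgSnd => if b then PAvgSnd else PList
  | PCstVar => if b then PCstVar else PSign
  | PSign => PNum b
  | PNum s => if b then PNumBit s else PDen false
  | PNumBit s => PNum s
  | PDen seen => if b then PDenBit seen else PList
  | PDenBit seen => PDen (seen || b)
  | PDone => PDone
  end.

Notation pletter := (pstate * bool)%type.

Fixpoint annotate (q : pstate) (w : seq bool) : seq pletter :=
  if w is b :: w' then (q, b) :: annotate (pnext q b) w' else [::].

(** The letters after which [offset] restarts: those before a unary number, and
    those before a numerator, whose length has to be measured. *)
Definition starts (l : pletter) : bool :=
  match l with
  | (PTag, true) | (PTag2, _) | (PMaxList, true) | (PAvgLhs, false)
  | (PAvgFst, false) | (PSign, _) => true
  | _ => false
  end.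

Notation letter0 := (PDone, false).

(** At the end of a unary number this is its value; at the end of a numerator
    with k digits it is 2 k, because of the flags. *)
Fixpoint offset (v : seq pletter) (p : nat) : nat :=
  if p is p'.+1 then
    if starts (nth letter0 v p') then 0 else (offset v p').+1
  else 0.

(** [Gvar] holds the variables of the instance. [ChA] and [ChB] are chains of
    squarings that pin down [Low] and [Zero]. [Pos] and [Neg] are the references
    for positive and negative numerators; their levels double every second
    position, in accordance with [offset], and [Pos'] and [Neg'] relay them.
    The other slots serve the constraint that is being read. *)
Inductive slot :=
  | Gvar | Zero | Low | ChA | ChB | Pos | Pos' | Neg | Neg'
  | Var | Up | UpR | Dn | DnR.

Definition slots : seq slot :=
  [:: Gvar; Zero; Low; ChA; ChB; Pos; Pos'; Neg; Neg'; Var; Up; UpR; Dn; DnR].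

Definition slot_code (s : slot) : nat :=
  match s with
  | Gvar => 0 | Zero => 1 | Low => 2 | ChA => 3 | ChB => 4 | Pos => 5
  | Pos' => 6 | Neg => 7 | Neg' => 8 | Var => 9 | Up => 10 | UpR => 11
  | Dn => 12 | DnR => 13
  end.

Notation slot_nth := (nth Gvar slots).
Notation nslots := 14.

Lemma slot_codeK : cancel slot_code slot_nth.
Proof. by case. Qed.

HB.instance Definition _ := Countable.copy slot (can_type slot_codeK).

Lemma slots_enum : Finite.axiom slots.
Proof. by case. Qed.

HB.instance Definition _ := isFinite.Build slot slots_enum.

Lemma slot_nthK k : k < nslots -> slot_code (slot_nth k) = k.
Proof. by do 14?case: k => [|k] //. Qed.

(** [Left s] is at the preceding position. [Ref s] is the variable of slot [s]
    whose index is the current offset: at the end of a unary number, the one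
    that the number names. *)
Inductive addr := One | Here of slot | Left of slot | Ref of slot.

(** What a 1x1 and a 2x2 semidefinite block can say: the sum over the first list
    is at least the sum over the second one, and m^2 <= u v with u, v >= 0. *)
Inductive lmi := Lin of seq addr & seq addr | Geo of addr & addr & addr.

Definition leq_lmi (a b : addr) : lmi := Lin [:: b] [:: a].
Definition eq_lmi (a b : addr) : seq lmi := [:: leq_lmi a b; leq_lmi b a].

(** [ChB] starts at 1/2 at least and is at least squared at each position, which
    bounds [Zero] from below. The ratio of [ChA] to [Low] starts at 2 at least
    and is at least squared at each position, up to a last link which is 1; this
    bounds [Low], hence the square of [Zero], from above. *)
Definition first_lmis : seq lmi :=
  [:: Lin [:: Here ChB; Here ChB] [:: One];
      Lin [:: Here ChA] [:: Here Low; Here Low]].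

Definition step_lmis : seq lmi :=
  eq_lmi (Here Zero) (Left Zero) ++ eq_lmi (Here Low) (Left Low) ++
  [:: Geo (Left ChA) (Here Low) (Here ChA);
      Geo (Left ChB) (Here ChB) One;
      leq_lmi (Left Pos') (Here Pos);
      Geo (Left Pos) (Here Pos') (Here Zero);
      leq_lmi (Left Neg') (Here Neg);
      Geo (Left Neg) (Here Neg') (Here Zero)].

Definition last_lmis : seq lmi :=
  [:: leq_lmi (Here ChB) (Here Zero);
      Geo (Here ChA) (Here Low) One;
      Geo (Here Zero) (Here Low) One;
      leq_lmi (Here Pos) One; leq_lmi (Here Pos') One;
      leq_lmi (Here Neg) (Here Low); leq_lmi (Here Neg') (Here Low)].

Definition common_lmis (l : pletter) : seq lmi :=
  (if l.1 == PStart then first_lmis else step_lmis) ++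
  (if l == (PList, false) then last_lmis else [::]).

Definition keep_var : seq lmi := eq_lmi (Here Var) (Left Var).

(** [Up] holds what remains of the sum that replaces a maximum. An average keeps
    its left-hand side in [Var] and its first entry in [UpR]. For a constant,
    [Up] and [Dn] run Horner's scheme for the numerator and for its opposite,
    with [UpR] and [DnR] as references, and go on through the denominator,
    with [Var] as the reference. *)
Definition local_lmis (l : pletter) : seq lmi :=
  let: (q, b) := l in
  match q with
  | PMaxLhs => if b then [::] else [:: leq_lmi (Ref Gvar) (Here Up)]
  | PMaxList =>
      if b then [:: leq_lmi (Left Up) (Here Up)] else [:: Lin [::] [:: Left Up]]
  | PMaxItem =>
      if b then [:: leq_lmi (Left Up) (Here Up)]
      else [:: Lin [:: Here Up; Ref Gvar] [:: Left Up]]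
  | PAvgLhs => if b then [::] else [:: leq_lmi (Ref Gvar) (Here Var)]
  | PAvgFst =>
      keep_var ++ if b then [::] else [:: leq_lmi (Here UpR) (Ref Gvar)]
  | PAvgSnd =>
      if b then keep_var ++ eq_lmi (Here UpR) (Left UpR)
      else [:: Geo (Left Var) (Left UpR) (Ref Gvar)]
  | PCstVar => if b then [::] else eq_lmi (Here Var) (Ref Gvar)
  | PSign =>
      keep_var ++
      [:: leq_lmi (Here Up) (Here Zero); leq_lmi (Here Dn) (Here Zero)]
  | PNum s =>
      keep_var ++
      [:: leq_lmi (Here Up) (Left Up); leq_lmi (Here Dn) (Left Dn);
          leq_lmi (Left UpR) (Here UpR); leq_lmi (Left DnR) (Here DnR)] ++
      if b then [::]
      else [:: leq_lmi (Here UpR) (Ref (if s then Neg else Pos));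
               leq_lmi (Here DnR) (Ref (if s then Pos else Neg))]
  | PNumBit s =>
      keep_var ++
      [:: leq_lmi (Left UpR) (Here UpR); leq_lmi (Left DnR) (Here DnR);
          Geo (Here Up) (Left Up) (Here (if b then UpR else Zero));
          Geo (Here Dn) (Left Dn) (Here (if b then DnR else Zero))]
  | PDen seen =>
      if b then
        keep_var ++ [:: leq_lmi (Here Up) (Left Up); leq_lmi (Here Dn) (Left Dn)]
      else [:: leq_lmi (Left Var) (Left Up); leq_lmi (Here Zero) (Left Dn)]
  | PDenBit seen =>
      keep_var ++
      [:: Geo (Here Up) (Left Up) (Here (if seen (+) b then Var else Zero));
          Geo (Here Dn) (Left Dn) (Here (if b then Var else Zero))]
  | _ => [::]
  end.

Definition lmis (l : pletter) : seq lmi := common_lmis l ++ local_lmis l.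

Definition nlmi : nat := (\max_(l : pletter) size (lmis l)).+1.

Lemma size_lmis l : size (lmis l) < nlmi.
Proof. by rewrite ltnS (leq_bigmax (F := fun l => size (lmis l))). Qed.

Notation width := (nlmi.*2).

Section MatrixEntries.
Local Open Scope ring_scope.

(** With coefficients for [mu] this is the entry of a matrix of the program, and
    with the values of a point it is the entry of the combined matrix. *)
Definition lmi_entry (V : zmodType) (mu : addr -> V) (C : lmi) (i j : bool) : V :=
  match C with
  | Lin ps ms =>
      if i || j then 0 else \sum_(a <- ps) mu a - \sum_(a <- ms) mu a
  | Geo m u v => if i (+) j then mu m else if i then mu v else mu u
  end.

Definition no_lmi : lmi := Lin [::] [::].

(** The constant matrix is subtracted in a semidefinite program, whence -1. *)
Definition addr_weight (f : option slot) (here left ref : bool) (a : addr) : rat :=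
  match f, a with
  | None, One => -1
  | Some f, Here s => ((s == f) && here)%:R
  | Some f, Left s => ((s == f) && left)%:R
  | Some f, Ref s => ((s == f) && ref)%:R
  | _, _ => 0
  end.

Definition diag_entry (f : option slot) (here left ref : bool) (l : pletter)
    (i j : nat) : rat :=
  if i./2 == j./2 then
    lmi_entry (addr_weight f here left ref) (nth no_lmi (lmis l) i./2) (odd i) (odd j)
  else 0.

Definition sdp_entry (v : seq pletter) (f : option slot) (t r c : nat) : rat :=
  if (r %/ width == c %/ width)%N then
    let p := (r %/ width)%N in
    diag_entry f (p == t) (p == t.+1) (offset v p == t) (nth letter0 v p)
      (r %% width) (c %% width)
  else 0.

Lemma lmi_entryC V mu C i j : @lmi_entry V mu C i j = lmi_entry mu C j i.
Proof. by case: C i j => [ps ms|m u w] [] []. Qed.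

Lemma sdp_entryC v f t r c : sdp_entry v f t r c = sdp_entry v f t c r.
Proof.
rewrite /sdp_entry eq_sym; case: eqP => // ->; rewrite /diag_entry eq_sym.
by case: eqP => // ->; rewrite lmi_entryC.
Qed.

End MatrixEntries.

Section SdpOf.
Local Open Scope ring_scope.
Variable v : seq pletter.
Let m := (size v * width)%N.

Definition sdp_family : {ffun 'I_(nslots * size v) -> 'M[rat]_m} :=
  [ffun i : 'I__ => \matrix_(r < m, c < m)
     sdp_entry v (Some (slot_nth (i %/ size v))) (i %% size v)%N r c].

Definition sdp_const : 'M[rat]_m :=
  \matrix_(r < m, c < m) sdp_entry v None 0 r c.

Lemma sdp_of_sym :
  [forall i, (sdp_family i)^T == sdp_family i] && (sdp_const^T == sdp_const).
Proof.
apply/andP; split; last by apply/eqP/matrixP => r c; rewrite !mxE sdp_entryC.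
by apply/forallP => i; apply/eqP/matrixP => r c; rewrite ffunE !mxE sdp_entryC.
Qed.

Definition sdp_of : sdp := SDP sdp_of_sym.
End SdpOf.

Definition reduction (I : max_average) : sdp :=
  sdp_of (annotate PStart (enc_max_average I)).

(** * Printing the semidefinite program *)

(** The loops over rows and over the indices of variables have no counters. A
    mark advances by one cell at each round, and the loop is over when the mark
    falls off the word. *)
Inductive ctrl :=
  | CInit
  | CRow of option slot & 'I_width
  | CNextRow of option slot
  | CMark of slot
  | CNextVar of slot
  | CDone.

Definition ctrl_code (c : ctrl) :
    (option slot * 'I_width + option slot) + ((slot + slot) + bool) :=
  match c with
  | CRow f a => inl (inl (f, a))
  | CNextRow f => inl (inr f)
  | CMark f => inr (inl (inl f))
  | CNextVar f => inr (inl (inr f))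
  | CInit => inr (inr false)
  | CDone => inr (inr true)
  end.

Definition ctrl_decode x : ctrl :=
  match x with
  | inl (inl (f, a)) => CRow f a
  | inl (inr f) => CNextRow f
  | inr (inl (inl f)) => CMark f
  | inr (inl (inr f)) => CNextVar f
  | inr (inr false) => CInit
  | inr (inr true) => CDone
  end.

Lemma ctrl_codeK : cancel ctrl_code ctrl_decode.
Proof. by case. Qed.

HB.instance Definition _ := Finite.copy ctrl (can_type ctrl_codeK).

(** The initial [PStart] also serves to recognise the first cell of a sweep. *)
Definition memory : finType := (pstate * (bool * bool))%type.
Definition mark : finType := (pletter * (bool * bool * bool))%type.
Notation cell := (bool + mark)%type.

Definition memory0 : memory := (PStart, (true, true)).

Definition cell_bits (f : option slot) (a : 'I_width) (x : mark) (left : bool) :=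
  let: (l, (here, ref, row)) := x in
  flatten [seq true :: enc_rat
    (if row then diag_entry f here left ref l a j else 0%R) | j <- iota 0 width].

Definition printer_scan (c : ctrl) (m : memory) (x : cell) : memory * cell * seq bool :=
  let: (q, (y, z)) := m in
  match x with
  | inl b =>
      if c is CInit
      then ((pnext q b, (false, starts (q, b))), inr ((q, b), (y, z, y)), [::])
      else (m, x, [::])
  | inr (l, (here, ref, row)) =>
      let first := q == PStart in
      match c with
      | CRow f a =>
          ((PDone, (here, false)), x,
           cell_bits f a (l, (here, ref, row)) (~~ first && y))
      | CNextRow f =>
          ((PDone, (row, false)), inr (l, (here, ref, ~~ first && y)), [::])
      | CMark f =>
          ((PDone, (false, starts l)), inr (l, (y, z, y)), [::])
      | CNextVar f =>
          ((PDone, (here, ref && ~~ starts l)),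
           inr (l, (~~ first && y, ~~ first && z, first)), [::])
      | _ => (m, x, [::])
      end
  end.

Lemma width_gt0 : 0 < width.
Proof. by []. Qed.

Definition first_row : 'I_width := Ordinal width_gt0.

Definition printer_next (c : ctrl) (m : memory) : ctrl * seq bool :=
  let: (q, (y, z)) := m in
  match c with
  | CInit => (CRow None first_row, [:: true])
  | CRow f a =>
      if insub a.+1 is Some a' then (CRow f a', [:: false; true])
      else (CNextRow f, [:: false])
  | CNextRow f =>
      if y then
        (if f is Some g then CNextVar g else CMark (slot_nth 0), [:: false])
      else (CRow f first_row, [:: true])
  | CMark f => (CRow (Some f) first_row, [:: true; true])
  | CNextVar f =>
      if y then
        if (slot_code f).+1 < nslots
        then (CMark (slot_nth (slot_code f).+1), [::])
        else (CDone, [:: false])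
      else (CRow (Some f) first_row, [:: true; true])
  | CDone => (CDone, [::])
  end.

Definition printer : passes :=
  @Passes ctrl memory mark CInit (pred1 CDone) memory0 printer_scan printer_next.

(** Reduces the effect of a sweep to what happens at each position. *)
Lemma pass_run_mkseq (P : passes) (c : pass_ctrl P) (q : nat -> pass_mem P)
    (x y : nat -> bool + pass_sym P) (e : nat -> seq bool) n :
  (forall p, p < n -> pass_scan c (q p) (x p) = (q p.+1, y p, e p)) ->
  pass_run c (q 0) (mkseq x n) = (q n, mkseq y n, flatten (mkseq e n)).
Proof.
rewrite /mkseq => step.
suff run k m : m + k <= n -> pass_run c (q m) [seq x i | i <- iota m k] =
    (q (m + k), [seq y i | i <- iota m k], flatten [seq e i | i <- iota m k]).
  exact: run.
elim: k m => [|k IHk] m le_mk /=; first by rewrite addn0.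
by rewrite step ?IHk -?addSnnS //; lia.
Qed.

Lemma flatten_iotaM (T : Type) (g : nat -> seq T) n k :
  flatten [seq g i | i <- iota 0 (n * k)] =
  flatten [seq flatten [seq g (p * k + a) | a <- iota 0 k] | p <- iota 0 n].
Proof.
elim: n => // n IHn; rewrite mulSn addnC iotaD map_cat flatten_cat IHn.
rewrite -[in RHS]addn1 iotaD map_cat flatten_cat /= cats0; congr (_ ++ _).
by rewrite add0n -{1}[n * k]addn0 iotaDl -map_comp.
Qed.

Lemma flatten_mkseq_nil (T : Type) n : flatten (mkseq (fun=> [::] : seq T) n) = [::].
Proof. by rewrite /mkseq; elim: (iota 0 n). Qed.

Section Printer.

Variables (w : seq bool).
Hypothesis w_gt0 : 0 < size w.
Let v := annotate PStart w.
Let N := size w.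

Lemma size_annotate q u : size (annotate q u) = size u.
Proof. by elim: u q => //= b u IHu q; rewrite IHu. Qed.

Lemma nth_annotate q u p : p < size u ->
  nth letter0 (annotate q u) p = (foldl pnext q (take p u), nth false u p).
Proof.
by elim: u q p => // b u IHu q [|p] //= lt_p; rewrite IHu.
Qed.

(** The tape when the current variable has index [t] and the rows being printed
    are those of position [r]. The marks for [t.+1] are those for [t] moved by
    one cell, the second one being erased where the offset restarts. *)
Definition tape_at (t r : nat) : seq cell :=
  mkseq (fun p => inr (nth letter0 v p, (p == t, offset v p == t, p == r))) N.

Arguments tape_at : simpl never.

Notation pstep := (@pass_step printer).

Definition row_string (f : option slot) (t i : nat) : seq bool :=
  flatten [seq true :: enc_rat (sdp_entry v f t i c) | c <- iota 0 (N * width)]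
  ++ [:: false].

Lemma init_step :
  pstep (CInit, [seq inl b | b <- w], [::]) =
  (CRow None first_row, tape_at 0 0, [:: true]).
Proof.
have -> : [seq inl b | b <- w] = mkseq (fun p => inl (nth false w p) : cell) N.
  apply: (@eq_from_nth _ (inl false)); rewrite ?size_mkseq size_map // => i lt_i.
  by rewrite nth_mkseq // (nth_map false).
rewrite /pass_step /=.
pose q p : memory := if p is p'.+1 then (foldl pnext PStart (take p w),
  (false, starts (nth letter0 v p'))) else memory0.
rewrite (@pass_run_mkseq printer CInit q _
  (fun p => inr (nth letter0 v p, (p == 0, offset v p == 0, p == 0)))
  (fun=> [::])); last first.
  move=> p lt_p; rewrite /= /v nth_annotate //.
  rewrite (take_nth false) // -cats1 foldl_cat /=.
  case: p lt_p => [|p] lt_p /=; first by rewrite take0.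
  by case: (starts (nth _ _ p)).
by case: (q N) => ? [? ?] /=; rewrite flatten_mkseq_nil.
Qed.

Lemma row_step f (a : 'I_width) t r o : r < N ->
  pstep (CRow f a, tape_at t r, o) =
  (if insub a.+1 is Some a' then CRow f a' else CNextRow f, tape_at t r,
   o ++ row_string f t (r * width + a) ++
   (if a.+1 < width then [:: true] else [::])).
Proof.
move=> lt_r; rewrite /pass_step /=.
pose q p : memory := if p is p'.+1 then (PDone, (p' == t, false)) else memory0.
rewrite (@pass_run_mkseq printer (CRow f a) q _
  (fun p => inr (nth letter0 v p, (p == t, offset v p == t, p == r)))
  (fun p => flatten [seq true :: enc_rat
     (sdp_entry v f t (r * width + a) (p * width + j)) | j <- iota 0 width])).
  case: (q N) => ? [? ?]; rewrite /row_string flatten_iotaM -!catA /=.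
  by case: insubP => [a' -> _|/negPf->].
move=> p lt_p; have -> : q p = ((q p).1, (q p).2) by case: (q p).
have left_p : ~~ ((q p).1 == PStart) && (q p).2.1 = (p == t.+1).
  by case: p {lt_p} => [|p].
have scan_p : printer_scan (CRow f a) (q p)
    (inr (nth letter0 v p, (p == t, offset v p == t, p == r))) =
  (q p.+1, inr (nth letter0 v p, (p == t, offset v p == t, p == r)),
   cell_bits f a (nth letter0 v p, (p == t, offset v p == t, p == r))
     (p == t.+1)).
  by rewrite -left_p /=; case: (q p) => ? [? ?].
rewrite -surjective_pairing [LHS]scan_p; congr (_, _, flatten _).
apply/eq_in_map => j; rewrite mem_iota add0n => /andP[_ lt_j].
rewrite /sdp_entry !divnMDl ?width_gt0 // !(divn_small (ltn_ord a)).
rewrite (divn_small lt_j) !addn0 !modnMDl (modn_small lt_j).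
by rewrite (modn_small (ltn_ord a)) eq_sym; case: eqP => // ->.
Qed.

Lemma next_row_step f t r o : r < N ->
  pstep (CNextRow f, tape_at t r, o) =
  (if r.+1 < N then (CRow f first_row, tape_at t r.+1, o ++ [:: true])
   else (if f is Some g then CNextVar g else CMark (slot_nth 0),
         tape_at t N, o ++ [:: false])).
Proof.
move=> lt_r; rewrite /pass_step /=.
pose q p : memory := if p is p'.+1 then (PDone, (p' == r, false)) else memory0.
rewrite (@pass_run_mkseq printer (CNextRow f) q _
  (fun p => inr (nth letter0 v p, (p == t, offset v p == t, p == r.+1)))
  (fun=> [::])); last by case.
rewrite flatten_mkseq_nil -/(tape_at t r.+1); move: lt_r; rewrite /q /N.
case: (size w) w_gt0 => // n _ lt_r; rewrite ltnS in lt_r; rewrite /= ltnS.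
by case: ltngtP lt_r => // ->.
Qed.

Lemma mark_step f t r o :
  pstep (CMark f, tape_at t r, o) =
  (CRow (Some f) first_row, tape_at 0 0, o ++ [:: true; true]).
Proof.
rewrite /pass_step /=.
pose q p : memory := if p is p'.+1 then (PDone, (false, starts (nth letter0 v p')))
  else memory0.
rewrite (@pass_run_mkseq printer (CMark f) q _
  (fun p => inr (nth letter0 v p, (p == 0, offset v p == 0, p == 0)))
  (fun=> [::])); last first.
  by case=> // p lt_p /=; case: (starts (nth _ _ p)).
by case: (q N) => ? [? ?] /=; rewrite flatten_mkseq_nil.
Qed.

Lemma next_var_step f t o : t < N ->
  pstep (CNextVar f, tape_at t N, o) =
  (if t.+1 < N then (CRow (Some f) first_row, tape_at t.+1 0, o ++ [:: true; true])
   else if (slot_code f).+1 < nslots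
   then (CMark (slot_nth (slot_code f).+1), tape_at N 0, o)
   else (CDone, tape_at N 0, o ++ [:: false])).
Proof.
move=> lt_t; rewrite /pass_step /=.
pose q p : memory := if p is p'.+1 then
  (PDone, (p' == t, (offset v p' == t) && ~~ starts (nth letter0 v p')))
  else memory0.
rewrite (@pass_run_mkseq printer (CNextVar f) q _
  (fun p => inr (nth letter0 v p, (p == t.+1, offset v p == t.+1, p == 0)))
  (fun=> [::])); last first.
  by case=> // p lt_p /=; case: (starts (nth _ _ p)); rewrite ?andbT ?andbF.
rewrite flatten_mkseq_nil -/(tape_at t.+1 0); move: lt_t; rewrite /q /N.
case: (size w) w_gt0 => // n _ lt_t; rewrite ltnS in lt_t; rewrite /= [t.+1 < _]ltnS.
case: (ltngtP t n) lt_t => // -> _.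
by case: ifP; rewrite ?cats0.
Qed.
Definition matrix_string (f : option slot) (t : nat) : seq bool :=
  flatten [seq true :: row_string f t i | i <- iota 0 (N * width)] ++ [:: false].

Lemma rows_run f t r k (a : 'I_width) o : r < N -> a + k.+1 = width ->
  iter k.+1 pstep (CRow f a, tape_at t r, o ++ [:: true]) =
  (CNextRow f, tape_at t r,
   o ++ flatten [seq true :: row_string f t i | i <- iota (r * width + a) k.+1]).
Proof.
move=> lt_r; elim: k a o => [|k IHk] a o def_k.
  rewrite iterS [iter 0 _ _]/= row_step //.
  have -> : (a.+1 < width) = false by rewrite -[X in _ < X]def_k addn1 ltnn.
  case: insubP => [a' lt_a _|_]; last by rewrite /= !cats0 -catA.
  by move: lt_a; rewrite -[X in _ < X]def_k addn1 ltnn.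
rewrite iterSr row_step //.
have lt_a : a.+1 < width by rewrite -[X in _ < X]def_k !addnS !ltnS leq_addr.
case: insubP => [a' _ def_a'|]; last by rewrite lt_a.
rewrite lt_a (catA (o ++ [:: true])) IHk; last by rewrite def_a' addSnnS.
by rewrite def_a' addnS; move: (row_string f t) => g; rewrite -!catA.
Qed.

Definition after_matrix (f : option slot) : ctrl :=
  if f is Some g then CNextVar g else CMark (slot_nth 0).

Lemma matrix_run f t k r o : r + k.+1 = N ->
  iter (k.+1 * width.+1) pstep (CRow f first_row, tape_at t r, o ++ [:: true]) =
  (after_matrix f, tape_at t N,
   o ++ flatten [seq true :: row_string f t i
                | i <- iota (r * width) (k.+1 * width)] ++ [:: false]).
Proof.
have row_run r' o' : r' < N ->
    iter width pstep (CRow f first_row, tape_at t r', o' ++ [:: true]) =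
    (CNextRow f, tape_at t r',
     o' ++ flatten [seq true :: row_string f t i | i <- iota (r' * width) width]).
  by move=> lt_r'; have := rows_run f t o' lt_r' (a := first_row) (k := width.-1) erefl;
     rewrite /= addn0.
elim: k r o => [|k IHk] r o def_k.
  have lt_r : r < N by rewrite -def_k addn1.
  rewrite !mul1n iterS row_run // next_row_step // -def_k addn1 ltnn.
  by rewrite -catA.
have lt_r : r < N by rewrite -def_k addnS ltnS leq_addr.
rewrite mulSn addnC iterD iterS row_run // next_row_step //.
have -> : r.+1 < N by rewrite -def_k !addnS !ltnS leq_addr.
rewrite IHk ?addSnnS // [in RHS]mulSn iotaD map_cat flatten_cat.
by rewrite -!catA [in RHS]addnC -mulSn.
Qed.

Lemma one_matrix_run f t o :
  iter (N * width.+1) pstep (CRow f first_row, tape_at t 0, o ++ [:: true]) =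
  (after_matrix f, tape_at t N, o ++ matrix_string f t).
Proof.
have [k def_N] : exists k, N = k.+1.
  by rewrite /N; case: (size w) w_gt0 => // k _; exists k.
by have := @matrix_run f t k 0 o; rewrite -def_N => ->.
Qed.

Definition after_family (f : slot) : ctrl :=
  if (slot_code f).+1 < nslots
  then CMark (slot_nth (slot_code f).+1) else CDone.

Lemma family_run f t k o : t + k.+1 = N ->
  iter (k.+1 * (N * width.+1).+1) pstep
    (CRow (Some f) first_row, tape_at t 0, o ++ [:: true; true]) =
  (after_family f, tape_at N 0,
   o ++ flatten [seq true :: matrix_string (Some f) i | i <- iota t k.+1] ++
   if (slot_code f).+1 < nslots then [::] else [:: false]).
Proof.
elim: k t o => [|k IHk] t o def_k.
  have lt_t : t < N by rewrite -def_k addn1.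
  rewrite mul1n iterS -(cat1s true [:: true]) catA one_matrix_run.
  rewrite next_var_step // -[in t.+1 < N]def_k addn1 ltnn /after_family.
  by case: ifP => _; rewrite /= ?cats0 -?catA.
have lt_t : t < N by rewrite -def_k addnS ltnS leq_addr.
rewrite mulSn addnC iterD iterS -(cat1s true [:: true]) catA one_matrix_run.
rewrite next_var_step //.
have -> : t.+1 < N by rewrite -def_k !addnS !ltnS leq_addr.
rewrite IHk ?addSnnS //.
by move: (matrix_string (Some f)) => g; rewrite -!catA.
Qed.

Lemma families_run k j t r o : j + k.+1 = nslots ->
  iter (k.+1 * (N * (N * width.+1).+1).+1) pstep
    (CMark (slot_nth j), tape_at t r, o) =
  (CDone, tape_at N 0,
   o ++ flatten [seq flatten [seq true :: matrix_string (Some (slot_nth i)) i'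
                             | i' <- iota 0 N] | i <- iota j k.+1] ++ [:: false]).
Proof.
have [n def_N] : exists n, N = n.+1.
  by rewrite /N; case: (size w) w_gt0 => // n _; exists n.
elim: k j t r o => [|k IHk] j t r o def_k.
  rewrite mul1n iterSr mark_step; have := @family_run (slot_nth j) 0 n o.
  rewrite -def_N => -> //.
  rewrite /after_family slot_nthK; last by rewrite -def_k addn1.
  by rewrite -def_k addn1 ltnn /= cats0.
have lt_j : j.+1 < nslots by rewrite -def_k !addnS !ltnS leq_addr.
rewrite mulSn addnC iterD iterSr mark_step.
have := @family_run (slot_nth j) 0 n o; rewrite -def_N => -> //.
rewrite /after_family slot_nthK ?lt_j; last exact: ltnW.
rewrite cats0 IHk ?addSnnS //.
by move: (fun i => matrix_string (Some (slot_nth i))) => g; rewrite -!catA.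
Qed.

Definition passes_count : nat :=
  1 + N * width.+1 + nslots * (N * (N * width.+1).+1).+1.

Lemma printer_run :
  iter passes_count pstep (CInit, [seq inl b | b <- w], [::]) =
  (CDone, tape_at N 0,
   matrix_string None 0 ++
   flatten [seq flatten [seq true :: matrix_string (Some (slot_nth i)) i'
                        | i' <- iota 0 N] | i <- iota 0 nslots] ++ [:: false]).
Proof.
rewrite /passes_count addnC iterD [1 + _]addnC iterD.
rewrite -[iter 1 _ _]/(pstep _) init_step.
by rewrite -[[:: true]]cat0s one_matrix_run cat0s (families_run (k := 13)).
Qed.
End Printer.

Lemma enc_rows_matrix (m : nat) (E : nat -> nat -> rat) :
  enc_rows (mx_rows (\matrix_(r < m, c < m) E r c)) =
  flatten [seq true :: flatten [seq true :: enc_rat (E r c) | c <- iota 0 m]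
                       ++ [:: false] | r <- iota 0 m] ++ [:: false].
Proof.
rewrite /enc_rows /enc_seq /mx_rows -val_enum_ord -!map_comp.
congr (flatten _ ++ _); apply: eq_map => r /=; congr (_ :: flatten _ ++ _).
by rewrite -!map_comp; apply: eq_map => c /=; rewrite mxE.
Qed.

Lemma enc_sdp_of (w : seq bool) :
  enc_sdp (sdp_of (annotate PStart w)) =
  matrix_string w None 0 ++
  flatten [seq flatten [seq true :: matrix_string w (Some (slot_nth i)) i'
                       | i' <- iota 0 (size w)] | i <- iota 0 nslots]
  ++ [:: false].
Proof.
set v := annotate PStart w.
have sz_v : size v = size w by rewrite size_annotate.
rewrite /enc_sdp [sdp_B _]/= /sdp_const enc_rows_matrix.
congr (_ ++ _); first by rewrite /sdp_dim /= sz_v.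
rewrite /enc_seq; congr (_ ++ _).
pose F i := true :: matrix_string w (Some (slot_nth (i %/ size w))) (i %% size w).
transitivity (flatten [seq F i | i <- iota 0 (nslots * size w)]).
  rewrite -[in RHS]sz_v -val_enum_ord -!map_comp; congr flatten.
  apply: eq_map => i /=; rewrite ffunE enc_rows_matrix /F /matrix_string /row_string.
  by move: (nat_of_ord i) => k; rewrite sz_v.
rewrite flatten_iotaM; congr flatten; apply: eq_map => i; congr flatten.
apply/eq_in_map => j; rewrite mem_iota add0n => /andP[_ lt_j].
rewrite /F divnMDl ?modnMDl; last exact: leq_ltn_trans lt_j.
by rewrite (divn_small lt_j) (modn_small lt_j) addn0.
Qed.

Lemma tm_outputs_within_leq (M : tm) w v t t' :
  t <= t' -> tm_outputs_within M w v t -> tm_outputs_within M w v t'.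
Proof.
move=> le_tt' [fin out]; rewrite /tm_outputs_within -(subnK le_tt') iterD.
set c := iter t _ _ in fin out *.
suff -> : iter (t' - t) (@tm_step M) c = c by [].
by elim: (t' - t) => //= k ->; rewrite /tm_step fin.
Qed.

Lemma reduction_polytime (R : realType) :
  @polytime_computable max_average_csp (sdp_feasibility R) reduction.
Proof.
pose K := emit_bound printer.
pose nP : {poly nat} := (1%N%:P + 'X * (width.+1)%:P +
  nslots%:P * ('X * ('X * (width.+1)%:P + 1%N%:P) + 1%N%:P))%R.
pose timeP : {poly nat} :=
  (nP * ('X * (K.+1)%:P + (K%:P + 'X + 2%N%:P)) + (nP * (('X + 1%N%:P) * K%:P) + 2%N%:P))%R.
exists (pass_tm printer), timeP => I; set w := encode I.
have w_gt0 : 0 < size w.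
  by rewrite /w /= /enc_max_average /enc_unary size_cat size_rcons.
have := @pass_tm_outputs printer (passes_count w) w (enc_sdp (reduction I)).
rewrite (printer_run w_gt0) /= eqxx => /(_ _ isT) out.
apply: tm_outputs_within_leq (out _); last by rewrite -enc_sdp_of.
rewrite /timeP /nP !(hornerD, hornerM, hornerC, hornerX).
rewrite /pass_time /passes_count.
have add1 n : (n + 1%N)%R = n.+1 := addn1 n.
have add2 n : (n + 2%N)%R = n.+2 := addn2 n.
by rewrite !add1 !add2 -/K addn2.
Qed.

Local Open Scope ring_scope.

(** * From semidefiniteness to local constraints *)

Lemma big_pairs (R : zmodType) (F : nat -> R) K :
  \sum_(i < K.*2) F i = \sum_(k < K) (F k.*2 + F k.*2.+1).
Proof.
elim: K => [|K IHK]; first by rewrite !big_ord0.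
by rewrite doubleS !big_ord_recr /= IHK addrA.
Qed.

(** Completing the square; for a zero leading coefficient, a point far away
    shows that the cross term vanishes. *)
Lemma quad_form_ge0 (R : realFieldType) (u w z : R) :
  (forall a b, 0 <= u * a ^+ 2 + w * (a * b) *+ 2 + z * b ^+ 2) <->
  [/\ 0 <= u, 0 <= z & w ^+ 2 <= u * z].
Proof.
split=> [pos|[u0 z0 det] a b].
  have u0 : 0 <= u by have := pos 1 0; lra.
  have z0 : 0 <= z by have := pos 0 1; lra.
  split=> //; case: (eqVneq u 0) => [u_eq0|nu]; last first.
    have up : 0 < u by rewrite lt_neqAle eq_sym nu.
    have : 0 <= u * (u * z - w ^+ 2) by have := pos w (- u); nra.
    by rewrite pmulr_rge0 // subr_ge0.
  case: (eqVneq w 0) => [->|nw]; first by rewrite u_eq0 expr0n mul0r.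
  pose a := (- z - 1) / (w *+ 2).
  have def_a : w * a *+ 2 = - z - 1 by rewrite /a; field; rewrite nw.
  by have := pos a 1; rewrite mulr1 def_a u_eq0; lra.
case: (eqVneq u 0) u0 det => [->|nu] u0 det.
  have -> : w = 0 by apply/eqP; rewrite -sqrf_eq0; rewrite eq_le sqr_ge0; lra.
  by rewrite !mul0r mul0rn !add0r mulr_ge0 // sqr_ge0.
have up : 0 < u by rewrite lt_neqAle eq_sym nu.
rewrite -(pmulr_rge0 _ up).
have -> : u * (u * a ^+ 2 + w * (a * b) *+ 2 + z * b ^+ 2) =
  (u * a + w * b) ^+ 2 + (u * z - w ^+ 2) * b ^+ 2 by ring.
by rewrite addr_ge0 ?sqr_ge0 // mulr_ge0 ?sqr_ge0 // subr_ge0.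
Qed.

Section BlockDiagonal.
Variables (R : realType) (K : nat) (g : nat -> bool -> bool -> R).
Hypothesis gC : forall k i j, g k i j = g k j i.

Definition block_entry (r c : nat) : R :=
  if r./2 == c./2 then g r./2 (odd r) (odd c) else 0.

Lemma block_quad_form (v : nat -> R) :
  \sum_(c < K.*2) (\sum_(r < K.*2) v r * block_entry r c) * v c =
  \sum_(k < K) (g k false false * v k.*2 ^+ 2 +
     g k false true * (v k.*2 * v k.*2.+1) *+ 2 + g k true true * v k.*2.+1 ^+ 2).
Proof.
rewrite (big_pairs (fun c => (\sum_(r < K.*2) v r * block_entry r c) * v c)).
apply: eq_bigr => k _; rewrite !(big_pairs (fun r => v r * block_entry r _)).
rewrite /block_entry.
have even2 n : n.*2./2 = n by rewrite doubleK.
have odd2 n : n.*2.+1./2 = n by rewrite /= uphalf_double.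
have parity n : (odd n.*2 = false) * (odd n.*2.+1 = true).
  by rewrite /= odd_double.
rewrite (bigD1 k) // big1 ?addr0 => [|i ne_ik]; last first.
  by rewrite !even2 !odd2 val_eqE (negPf ne_ik) !mulr0 addr0.
rewrite (bigD1 k) // big1 ?addr0 => [|i ne_ik]; last first.
  by rewrite !even2 !odd2 val_eqE (negPf ne_ik) !mulr0 addr0.
rewrite !even2 !odd2 !eqxx !parity (gC k true false).
rewrite /= !addr0; ring.
Qed.

Lemma block_psd (m : nat) (dim_m : m = K.*2) (S : 'M[R]_m) :
  (forall r c, S r c = block_entry r c) ->
  psd S <-> forall k, (k < K)%N ->
    [/\ 0 <= g k false false, 0 <= g k true true &
        g k false true ^+ 2 <= g k false false * g k true true].
Proof.
move: S; rewrite dim_m => S defS.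
have quad (v : 'cV_(K.*2)) (u : nat -> R) : (forall i : 'I_(K.*2), v i 0 = u i) ->
    (v^T *m S *m v) 0 0 = \sum_(k < K) (g k false false * u k.*2 ^+ 2 +
     g k false true * (u k.*2 * u k.*2.+1) *+ 2 + g k true true * u k.*2.+1 ^+ 2).
  move=> def_v; rewrite -block_quad_form mxE; apply: eq_bigr => c _.
  rewrite mxE def_v; congr (_ * _); apply: eq_bigr => r _.
  by rewrite mxE def_v defS.
split=> [[_ pos] k lt_k|pos].
  apply/quad_form_ge0 => a b.
  pose u n := if n == k.*2 then a else if n == k.*2.+1 then b else 0.
  have := pos (\col_i u i); rewrite (quad _ u) => [|i]; last by rewrite mxE.
  rewrite (bigD1 (Ordinal lt_k)) //= big1 ?addr0 => [|i ne_ik].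
    by rewrite /u eqxx -(eqn_add2r 0) gtn_eqF ?eqxx.
  have neq : (i == k :> nat) = false by rewrite -(negPf ne_ik).
  have e1 : (i.*2 == k.*2) = false by rewrite -neq; lia.
  have e2 : (i.*2 == k.*2.+1) = false by lia.
  have e3 : (i.*2.+1 == k.*2) = false by lia.
  have e4 : (i.*2.+1 == k.*2.+1) = false by rewrite eqSS e1.
  by rewrite /u e1 e2 e3 e4; ring.
split; first by apply/matrixP => r c; rewrite mxE !defS /block_entry eq_sym;
  case: eqP => // ->; rewrite gC.
move=> v; pose u n := if insub n is Some i then v i 0 else 0.
rewrite (quad v u) => [|i]; last by rewrite /u valK.
by apply: sumr_ge0 => k _; have /quad_form_ge0 := pos k (ltn_ord k); apply.
Qed.
End BlockDiagonal.

Section LocalConstraints.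
Variable R : realType.

Definition lmi_holds (mu : addr -> R) (C : lmi) : Prop :=
  match C with
  | Lin ps ms => \sum_(a <- ms) mu a <= \sum_(a <- ps) mu a
  | Geo m u v => [/\ 0 <= mu u, 0 <= mu v & mu m ^+ 2 <= mu u * mu v]
  end.

Definition lmis_hold (mu : addr -> R) (Cs : seq lmi) : Prop :=
  foldr (fun C P => lmi_holds mu C /\ P) True Cs.

Lemma lmis_holdP mu Cs :
  lmis_hold mu Cs <-> forall k, lmi_holds mu (nth no_lmi Cs k).
Proof.
elim: Cs => [|C Cs IH] /=.
  by split=> // _ k; rewrite nth_nil /= big_nil.
split=> [[hC /IH hCs] [|k]|all] //=; split; first exact: (all 0%N).
by apply/IH => k; apply: (all k.+1).
Qed.

Lemma lmi_holdsP mu C :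
  lmi_holds mu C <->
  [/\ 0 <= lmi_entry mu C false false, 0 <= lmi_entry mu C true true &
      lmi_entry mu C false true ^+ 2 <=
      lmi_entry mu C false false * lmi_entry mu C true true].
Proof.
case: C => [ps ms|m u v] //=; rewrite subr_ge0 mulr0 expr0n lexx.
by split=> [|[]].
Qed.

Lemma lmi_entry_sum (I : finType) (x : I -> R) (mu : I -> addr -> rat)
    (mu0 : addr -> rat) C i j :
  \sum_k x k * ratr (lmi_entry (mu k) C i j) - ratr (lmi_entry mu0 C i j) =
  lmi_entry (fun a => \sum_k x k * ratr (mu k a) - ratr (mu0 a)) C i j.
Proof.
case: C => [ps ms|m u v] /=; last by case: (i (+) j); case: i.
case: (i || j); first by rewrite rmorph0 big1 ?subr0 // => k _; rewrite mulr0.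
have lin (s : seq addr) : \sum_k x k * ratr (\sum_(a <- s) mu k a) -
    ratr (\sum_(a <- s) mu0 a) =
    \sum_(a <- s) (\sum_k x k * ratr (mu k a) - ratr (mu0 a)).
  rewrite sumrB rmorph_sum exchange_big; congr (_ - _).
  by apply: eq_bigr => k _; rewrite rmorph_sum mulr_sumr.
rewrite -!lin rmorphB.
under eq_bigr do rewrite rmorphB mulrBr.
by rewrite sumrB; ring.
Qed.

Definition addr_value (v : seq pletter) (y : slot -> nat -> R) (p : nat) (a : addr) :=
  match a with
  | One => 1
  | Here s => y s p
  | Left s => if p is p'.+1 then y s p' else 0
  | Ref s => y s (offset v p)
  end.

End LocalConstraints.
Section Feasible.
Variables (R : realType) (v : seq pletter).
Local Notation N := (size v).

Let g (y : slot -> nat -> R) (k : nat) (i j : bool) : R :=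
  lmi_entry (addr_value v y (k %/ nlmi))
    (nth no_lmi (lmis (nth letter0 v (k %/ nlmi))) (k %% nlmi)) i j.

Lemma sdp_entryE f t r c :
  sdp_entry v f t r c =
  if r./2 == c./2 then
    let p := (r./2 %/ nlmi)%N in
    lmi_entry (addr_weight f (p == t) (p == t.+1) (offset v p == t))
      (nth no_lmi (lmis (nth letter0 v p)) (r./2 %% nlmi)) (odd r) (odd c)
  else 0.
Proof.
have wE n : [/\ (n %/ width = n./2 %/ nlmi)%N, ((n %% width)./2 = n./2 %% nlmi)%N
    & odd (n %% width) = odd n].
  rewrite -[in X in X = _]mul2n divnMA divn2 -!divn2 modn_divl muln2.
  by rewrite odd_mod ?odd_double.
rewrite /sdp_entry /diag_entry.
have [-> -> ->] := wE r; have [-> -> ->] := wE c.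
case: (altP (r./2 =P c./2)) => [->|ne_rc]; first by rewrite !eqxx.
case: eqP => // eq_div; case: eqP => // eq_mod.
by rewrite (divn_eq r./2 nlmi) eq_div eq_mod -divn_eq eqxx in ne_rc.
Qed.

Section Weights.

Variables (x : 'I_(nslots * N) -> R) (y : slot -> nat -> R).
Hypothesis def_x : forall i, x i = y (slot_nth (i %/ N)) (i %% N)%N.

(** The variable of slot [s] and index [t] has index [slot_code s * N + t] in the
    program. *)
Lemma sum_select s t : (t < N)%N ->
  \sum_i x i * ratr ((s == slot_nth (i %/ N)) && (t == i %% N)%N)%:R = y s t.
Proof.
move=> lt_t; have N_gt0 : (0 < N)%N by apply: leq_ltn_trans lt_t.
have lt_i : (slot_code s * N + t < nslots * N)%N.
  apply: (@leq_trans ((slot_code s).+1 * N)%N); first by rewrite mulSn addnC ltn_add2r.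
  by rewrite leq_mul2r; case: (s); rewrite orbT.
rewrite (bigD1 (Ordinal lt_i)) //= big1 ?addr0 => [|i ne_i].
  rewrite divnMDl // modnMDl (divn_small lt_t) (modn_small lt_t) addn0.
  rewrite slot_codeK !eqxx rmorph1 mulr1 def_x /=.
  by rewrite divnMDl // modnMDl (divn_small lt_t) (modn_small lt_t) addn0 slot_codeK.
case: andP => [[/eqP def_s /eqP def_t]|_]; last by rewrite rmorph0 mulr0.
case/eqP: ne_i; apply: val_inj; rewrite /= def_s def_t slot_nthK -?divn_eq //.
by rewrite ltn_divLR.
Qed.

Lemma weight_value p a : (p < N)%N ->
  \sum_i x i * ratr (addr_weight (Some (slot_nth (i %/ N))) (p == i %% N)%N
     (p == (i %% N).+1)%N (offset v p == i %% N)%N a)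
  - ratr (addr_weight None (p == 0)%N (p == 1)%N (offset v p == 0)%N a)
  = addr_value v y p a.
Proof.
move=> lt_p; have le_off : (offset v p <= p)%N.
  by elim: (p) => //= k IHk; case: ifP.
case: a => [|s|s|s] /=.
- rewrite big1 => [|i _]; last by rewrite rmorph0 mulr0.
  by rewrite rmorphN1 opprK add0r.
- by rewrite rmorph0 subr0 sum_select.
- rewrite rmorph0 subr0; case: p lt_p {le_off} => [|p] lt_p.
    by rewrite big1 // => i _; rewrite andbF rmorph0 mulr0.
  by rewrite -(sum_select s (ltnW lt_p)).
- by rewrite rmorph0 subr0 sum_select //; apply: leq_ltn_trans lt_p.
Qed.

Lemma sdp_of_entry r c :
  (\sum_i x i *: map_mx ratr (sdp_A (sdp_of v) i)
     - map_mx ratr (sdp_B (sdp_of v))) r c = block_entry (g y) r c.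
Proof.
rewrite !mxE summxE.
under eq_bigr do rewrite !mxE ffunE !mxE sdp_entryE.
rewrite sdp_entryE /block_entry.
case: eqP => _ /=; last first.
  by rewrite rmorph0 subr0 big1 // => i _; rewrite mulr0.
rewrite lmi_entry_sum /g; congr lmi_entry; apply: funext => a.
apply: weight_value.
rewrite -divn2 -divnMA mul2n ltn_divLR //; exact: ltn_ord.
Qed.
End Weights.

Lemma sdp_of_feasible :
  sdp_feasible R (sdp_of v) <->
  exists y : slot -> nat -> R, forall p, (p < N)%N ->
    lmis_hold (addr_value v y p) (lmis (nth letter0 v p)).
Proof.
have gC y k i j : g y k i j = g y k j i by rewrite /g lmi_entryC.
have dimE : (N * width)%N = (N * nlmi).*2 by rewrite -!muln2 mulnA.
have psdE (x : 'I_(nslots * N) -> R) y :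
  (forall i, x i = y (slot_nth (i %/ N)) (i %% N)%N) ->
  psd (\sum_i x i *: map_mx ratr (sdp_A (sdp_of v) i)
     - map_mx ratr (sdp_B (sdp_of v))) <->
  forall p, (p < N)%N -> lmis_hold (addr_value v y p) (lmis (nth letter0 v p)).
  move=> def_x; rewrite (block_psd (gC y) dimE (sdp_of_entry def_x)).
  split=> [holds p lt_p|holds k lt_k].
    apply/lmis_holdP => k; have [lt_k|le_k] := ltnP k nlmi; last first.
      rewrite nth_default /= ?big_nil //.
      by apply: leq_trans le_k; apply: ltnW; apply: size_lmis.
    apply/lmi_holdsP; have lt_pk : (p * nlmi + k < N * nlmi)%N.
      apply: (@leq_trans (p.+1 * nlmi)%N); last by rewrite leq_mul2r lt_p orbT.
      by rewrite mulSn addnC ltn_add2r.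
    have := holds _ lt_pk; rewrite /g divnMDl // modnMDl (divn_small lt_k).
    by rewrite (modn_small lt_k) addn0.
  apply/lmi_holdsP; move: (k %% nlmi)%N; apply/lmis_holdP; apply: holds.
  by rewrite ltn_divLR.
split=> [[x feas]|[y holds]]; last first.
  by exists (fun i => y (slot_nth (i %/ N)) (i %% N)%N); apply/psdE.
pose y s t : R := if insub (slot_code s * N + t)%N is Some i then x i else 0.
exists y; apply/(psdE x) => // i; rewrite /y.
have N_gt0 : (0 < N)%N by have := leq_ltn_trans (leq0n i) (ltn_ord i); rewrite muln_gt0.
by rewrite slot_nthK -?divn_eq ?valK // ltn_divLR.
Qed.
End Feasible.

(** * Doubly exponential reference values *)

Section Pow2.
Variable R : realType.
Implicit Types a b c x y : R.

Definition pow2 c : R := expR (c * ln 2).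

Lemma pow2_gt0 c : 0 < pow2 c. Proof. exact: expR_gt0. Qed.
Lemma pow2_ge0 c : 0 <= pow2 c. Proof. exact: expR_ge0. Qed.
Lemma pow2D a b : pow2 (a + b) = pow2 a * pow2 b.
Proof. by rewrite /pow2 mulrDl expRD. Qed.
Lemma pow2_0 : pow2 0 = 1. Proof. by rewrite /pow2 mul0r expR0. Qed.
Lemma pow2_1 : pow2 1 = 2.
Proof. by rewrite /pow2 mul1r lnK // posrE. Qed.

Lemma pow2N1 : pow2 (-1) *+ 2 = 1.
Proof. by rewrite -mulr_natl -pow2_1 -pow2D subrr pow2_0. Qed.

Lemma ln2_gt0 : 0 < ln (2 : R).
Proof. by apply: ln_gt0; rewrite ltr1n. Qed.

Lemma ler_pow2 : {mono pow2 : a b / a <= b}.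
Proof. by move=> a b; rewrite ler_expR ler_pM2r // ln2_gt0. Qed.

Lemma pow2_total x : 0 < x -> exists c, pow2 c = x.
Proof.
move=> x_gt0; exists (ln x / ln 2); rewrite /pow2 divfK ?lnK ?posrE //.
by rewrite gt_eqF // ln2_gt0.
Qed.

Lemma pow2_nat n : pow2 n%:R = 2 ^+ n.
Proof. by rewrite /pow2 expRM_natl lnK // posrE. Qed.

Lemma le_half (m u w : R) c1 c2 :
  0 <= u -> 0 <= w -> m ^+ 2 <= u * w ->
  u <= pow2 c1 -> w <= pow2 c2 -> m <= pow2 ((c1 + c2) / 2).
Proof.
move=> u0 w0 muw uc wc; have [m0|m0] := lerP m 0.
  by apply: le_trans m0 (pow2_ge0 _).
rewrite -(@ler_pXn2r _ 2) ?nnegrE ?pow2_ge0 ?(ltW m0) //.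
apply: le_trans muw _; rewrite expr2 -pow2D -splitr pow2D.
exact: ler_pM.
Qed.

Lemma eq_ler x y : x = y -> x <= y. Proof. by move=> ->. Qed.

Lemma pow2_half m c1 c2 : m *+ 2 = c1 + c2 -> pow2 m ^+ 2 = pow2 c1 * pow2 c2.
Proof. by move=> E; rewrite expr2 -!pow2D -mulr2n E. Qed.
End Pow2.

Section Common.
Variables (R : realType) (v : seq pletter).
Local Notation N := (size v).
Hypothesis N_gt1 : (1 < N)%N.
Hypothesis v_first : forall p, (p < N)%N ->
  ((nth letter0 v p).1 == PStart) = (p == 0)%N.
Hypothesis v_last : forall p, (p < N)%N ->
  (nth letter0 v p == (PList, false)) = (p == N.-1)%N.

Definition top_level : R := 2 ^+ N.-1.
(** Levels are logarithms relative to [Zero], which has level 0. *)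
Definition level (c : R) : R := pow2 (c - top_level).
Definition ref_level (p : nat) : R := 2 ^+ N.-1 / 2 ^+ (N - p)./2.

Lemma ref_level_top p : (N.-1 <= p)%N -> ref_level p = top_level.
Proof.
move=> le_p; rewrite /ref_level -/top_level.
have -> : ((N - p)./2 = 0)%N by lia.
by rewrite expr0 divr1.
Qed.

Lemma ref_levelSS p : (p.+1 < N)%N -> ref_level p *+ 2 = ref_level p.+2.
Proof.
move=> lt_p; rewrite /ref_level.
have -> : ((N - p)./2 = (N - p.+2)./2.+1)%N by lia.
rewrite exprS; field.
by rewrite expf_neq0 // pnatr_eq0.
Qed.

Definition common_value (s : slot) (p : nat) : R :=
  match s with
  | Zero => level 0
  | Low => level (- top_level)
  | ChA => pow2 (2 ^+ p - top_level - top_level)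
  | ChB => pow2 (- 2 ^+ p)
  | Pos => level (ref_level p)
  | Pos' => level (ref_level p.+1)
  | Neg => level (- ref_level p)
  | Neg' => level (- ref_level p.+1)
  | _ => 0
  end.

Definition is_common (s : slot) : bool :=
  match s with
  | Zero | Low | ChA | ChB | Pos | Pos' | Neg | Neg' => true
  | _ => false
  end.

Lemma lmis_hold_cat (mu : addr -> R) Cs Ds :
  lmis_hold mu (Cs ++ Ds) <-> lmis_hold mu Cs /\ lmis_hold mu Ds.
Proof.
elim: Cs => [|C Cs IH] /=; first by split=> [|[]].
by split=> [[? /IH[]]|[[? ?] ?]]; do ?split=> //; apply/IH.
Qed.

Definition lmiE := (big_cons, big_nil, addr0).

Lemma common_feasible (y : slot -> nat -> R) :
  (forall s p, is_common s -> y s p = common_value s p) ->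
  forall p, (p < N)%N ->
    lmis_hold (addr_value v y p) (common_lmis (nth letter0 v p)).
Proof.
move=> def_y p lt_p; apply/lmis_hold_cat; rewrite v_first // v_last //; split.
  case: p lt_p => [|p] lt_p /=; rewrite !lmiE /= !def_y //=.
    rewrite expr0 -!mulr2n; split; last split=> //.
      by rewrite pow2N1.
    by rewrite -mulr_natl -pow2_1 -pow2D /level ler_pow2; lra.
  rewrite /level !lexx ?pow2_ge0; do !split=> //; rewrite ?pow2_ge0 //;
    apply: eq_ler.
  - apply: pow2_half; rewrite exprS; ring.
  - rewrite -[X in _ * X]pow2_0; apply: pow2_half; rewrite exprS; ring.
  - apply: pow2_half; have := ref_levelSS lt_p; lra.
  - apply: pow2_half; have := ref_levelSS lt_p; lra.
case: eqP => // def_p; rewrite /= !lmiE /= !def_y //= /level def_p.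
have eN : N.-1.+1 = N by lia.
rewrite !ref_level_top ?eN ?leq_pred //.
rewrite subrr pow2_0 !pow2_ge0 ler01 !lexx mulr1 ler_pow2 /top_level.
do !split=> //; first by rewrite sub0r.
- by rewrite -[leRHS]mulr1 -[X in _ * X]pow2_0; apply: eq_ler; apply: pow2_half; ring.
- by rewrite -[leRHS]mulr1 -[X in _ * X]pow2_0; apply: eq_ler; apply: pow2_half; ring.
Qed.

(** [Zero] is caught between the chains. The references are bounded by
    induction from the last position, where they are at most 1 and [Low], of
    levels [top_level] and [- top_level]. *)
Lemma common_bounds (y : slot -> nat -> R) :
  (forall p, (p < N)%N ->
    lmis_hold (addr_value v y p) (common_lmis (nth letter0 v p))) ->
  forall p, (p < N)%N ->
    [/\ y Zero p = level 0, y Pos p <= level (ref_level p)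
      & y Neg p <= level (- ref_level p)].
Proof.
move=> feas.
have first : lmis_hold (addr_value v y 0) first_lmis.
  by have /lmis_hold_cat[] := feas 0%N (ltnW N_gt1); rewrite v_first // ltnW.
have step p : (p.+1 < N)%N -> lmis_hold (addr_value v y p.+1) step_lmis.
  by move=> lt_p; have /lmis_hold_cat[] := feas _ lt_p; rewrite v_first.
have lt_last : (N.-1 < N)%N by lia.
have last : lmis_hold (addr_value v y N.-1) last_lmis.
  by have /lmis_hold_cat[_] := feas _ lt_last; rewrite v_last // eqxx.
have {}step p : (p.+1 < N)%N ->
  [/\ y Zero p.+1 = y Zero p /\ y Low p.+1 = y Low p,
   [/\ 0 <= y Low p.+1, 0 <= y ChA p.+1 & y ChA p ^+ 2 <= y Low p.+1 * y ChA p.+1],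
   y ChB p ^+ 2 <= y ChB p.+1,
   [/\ y Pos' p <= y Pos p.+1, 0 <= y Pos' p.+1, 0 <= y Zero p.+1 &
       y Pos p ^+ 2 <= y Pos' p.+1 * y Zero p.+1] &
   [/\ y Neg' p <= y Neg p.+1, 0 <= y Neg' p.+1, 0 <= y Zero p.+1 &
       y Neg p ^+ 2 <= y Neg' p.+1 * y Zero p.+1]].
  move=> /step /=; rewrite !lmiE /= => -[z1 [z2 [l1 [l2 [[a1 a2 a3] [[b1 b2 b3]
    [p1 [[p2 p3 p4] [n1 [[n2 n3 n4] _]]]]]]]]]].
  split=> //; first by split; apply/eqP; rewrite eq_le ?z1 ?z2 ?l1 ?l2.
  by rewrite mulr1 in b3.
move: first last; rewrite /= !lmiE /=.
move=> [b0 [a0 _]] [lb [[la1 la2 la3] [[z1 z2 z3] [pt [pt' [nt [nt' _]]]]]]].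
have zero_const p : (p < N)%N -> y Zero p = y Zero 0%N /\ y Low p = y Low 0%N.
  elim: p => // p IHp lt_p; have [[-> ->] _ _ _ _] := step p lt_p.
  exact: IHp (ltnW lt_p).
have [zN lN] := zero_const _ lt_last.
have b_low p : (p < N)%N -> pow2 (- 2 ^+ p) <= y ChB p.
  elim: p => [|p IHp] lt_p.
    by rewrite expr0; have := pow2N1 R; lra.
  have [_ _ b_step _ _] := step p lt_p; apply: le_trans b_step.
  rewrite (_ : pow2 _ = pow2 (- 2 ^+ p) ^+ 2); last first.
    by rewrite expr2 -pow2D; congr pow2; rewrite exprS; ring.
  have {}IHp := IHp (ltnW lt_p); rewrite ler_pXn2r ?nnegrE ?pow2_ge0 //.
  exact: le_trans (pow2_ge0 _) IHp.
have low_ge0 : 0 <= y Low 0%N by rewrite -lN.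
have a_low p : (p < N)%N -> pow2 (2 ^+ p) * y Low 0%N <= y ChA p.
  elim: p => [|p IHp] lt_p; first by rewrite expr0 pow2_1; lra.
  have [[_ lp] [_ a_ge0 a_step] _ _ _] := step p lt_p.
  have {}IHp := IHp (ltnW lt_p); have [_ lpS] := zero_const _ lt_p.
  rewrite lpS in a_step.
  have [l0|l_gt0] := leP (y Low 0%N) 0.
    have -> : y Low 0%N = 0 by apply/eqP; rewrite eq_le l0.
    by rewrite mulr0.
  rewrite -(ler_pM2l l_gt0); apply: le_trans a_step.
  have -> : pow2 (2 ^+ p.+1 : R) = pow2 (2 ^+ p) ^+ 2.
    by rewrite expr2 -pow2D; congr pow2; rewrite exprS; ring.
  rewrite mulrCA -expr2 -exprMn ler_pXn2r ?nnegrE //.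
    by rewrite mulr_ge0 ?pow2_ge0.
  by apply: le_trans IHp; rewrite mulr_ge0 ?pow2_ge0.
have low_le : y Low 0%N <= level (- top_level).
  have [l0|l_gt0] := leP (y Low 0%N) 0; first exact: le_trans l0 (pow2_ge0 _).
  have := a_low _ lt_last; set c := pow2 _ => ca.
  have cl_ge0 : 0 <= c * y Low 0%N by rewrite mulr_ge0 ?pow2_ge0.
  have : (c * y Low 0%N) ^+ 2 <= y Low 0%N.
    apply: le_trans (_ : y ChA N.-1 ^+ 2 <= _); last by rewrite -lN -[leRHS]mulr1.
    by rewrite ler_pXn2r ?nnegrE // (le_trans cl_ge0).
  rewrite exprMn [y _ _ ^+ 2]expr2 mulrA -[X in _ <= X]mul1r ler_pM2r // => cy.
  have cc_gt0 : 0 < c ^+ 2 by rewrite exprn_gt0 // pow2_gt0.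
  rewrite -(ler_pM2l cc_gt0); apply: le_trans cy _.
  rewrite /level /c expr2 -!pow2D -[X in X <= _]pow2_0 ler_pow2 /top_level.
  lra.
have zero_le : y Zero 0%N <= level 0.
  rewrite -zN (_ : level 0 = pow2 ((- top_level - top_level + 0) / 2)); last first.
    by rewrite /level; congr pow2; lra.
  by apply: (le_half z1 z2 z3); rewrite ?lN ?pow2_0.
have zero_eq : y Zero 0%N = level 0.
  apply/eqP; rewrite eq_le zero_le /= -zN; apply: le_trans lb.
  by apply: le_trans (b_low _ lt_last); rewrite /level sub0r.
have refs j : (j < N)%N ->
    [/\ y Pos (N.-1 - j)%N <= level (ref_level (N.-1 - j)),
        y Pos' (N.-1 - j)%N <= level (ref_level (N.-1 - j).+1),
        y Neg (N.-1 - j)%N <= level (- ref_level (N.-1 - j)) &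
        y Neg' (N.-1 - j)%N <= level (- ref_level (N.-1 - j).+1)].
  elim: j => [|j IHj] lt_j.
    rewrite subn0 !ref_level_top ?leqnSn //.
    rewrite {1 2}/level subrr pow2_0; split=> //.
      by apply: le_trans nt _; rewrite lN.
    by apply: le_trans nt' _; rewrite lN.
  have [IH1 IH2 IH3 IH4] := IHj (ltnW lt_j).
  have lt_p : ((N.-1 - j.+1).+1 < N)%N by clear - lt_j; lia.
  have eSj : (N.-1 - j = (N.-1 - j.+1).+1)%N by clear - lt_j; lia.
  move: IH1 IH2 IH3 IH4; rewrite eSj; move: (N.-1 - j.+1)%N lt_p => p lt_p.
  move=> IH1 IH2 IH3 IH4; have refSS := ref_levelSS lt_p.
  have [_ _ _ [p1 p2 p3 p4] [n1 n2 n3 n4]] := step p lt_p.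
  have [zp _] := zero_const _ lt_p.
  split; try exact: le_trans p1 IH1; try exact: le_trans n1 IH3.
    rewrite (_ : level _ = pow2 ((ref_level p.+2 - top_level + (0 - top_level)) / 2)).
      by apply: (le_half p2 p3 p4) => //; rewrite zp zero_eq.
    by rewrite /level -refSS; congr pow2; field.
  rewrite (_ : level _ = pow2 ((- ref_level p.+2 - top_level + (0 - top_level)) / 2)).
    by apply: (le_half n2 n3 n4) => //; rewrite zp zero_eq.
  by rewrite /level -refSS; congr pow2; field.
move=> p lt_p; have [zp _] := zero_const _ lt_p.
have [] := refs (N.-1 - p)%N; first by clear - lt_p; lia.
have -> : (N.-1 - (N.-1 - p) = p)%N by clear - lt_p; lia.
by rewrite zp zero_eq.
Qed.
End Common.

(** * What the letters of a constraint express *)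

Section LocalAnalysis.
Variable R : realType.
Implicit Types (G : slot -> nat -> R) (e prev cur mid : slot -> R).
Implicit Types (ls : seq pletter) (es : seq (slot -> R)) (w : seq bool).

(** The slots at two successive positions are passed as functions, so that the
    letters of a constraint can be studied wherever they occur. *)
Definition local_value G prev cur (d : nat) (a : addr) : R :=
  match a with
  | One => 1
  | Here s => cur s
  | Left s => prev s
  | Ref s => G s d
  end.

Variables (T : R) (G : slot -> nat -> R).
Local Notation lev c := (pow2 (c - T)).
Local Notation z := (lev 0).

Definition allowed prev cur d l : Prop :=
  lmis_hold (local_value G prev cur d) (local_lmis l).

Fixpoint along prev (d : nat) ls es : Prop :=
  match ls, es with
  | l :: ls', e :: es' =>
      [/\ e Zero = z, allowed prev e d l &
          along e (if starts l then 0%N else d.+1) ls' es']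
  | [::], [::] => True
  | _, _ => False
  end.

Arguments along : simpl never.

Lemma along_cons prev d l ls es : along prev d (l :: ls) es ->
  exists cur es', [/\ cur Zero = z, allowed prev cur d l &
    along cur (if starts l then 0%N else d.+1) ls es'].
Proof. by case: es => // e es [ez a h]; exists e, es. Qed.

Lemma along_consI prev d l ls cur : cur Zero = z -> allowed prev cur d l ->
  (exists es, along cur (if starts l then 0%N else d.+1) ls es) ->
  exists es, along prev d (l :: ls) es.
Proof. by move=> cz a [es h]; exists (cur :: es). Qed.

Lemma annotate_cat q w1 w2 :
  annotate q (w1 ++ w2) = annotate q w1 ++ annotate (foldl pnext q w1) w2.
Proof. by elim: w1 q => //= b w1 IH q; rewrite IH. Qed.

Lemma annotate_unary q k w : pnext q true = q ->
  annotate q (enc_unary k ++ w) =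
  nseq k (q, true) ++ (q, false) :: annotate (pnext q false) w.
Proof. by move=> loop; elim: k => //= k IHk; rewrite /enc_unary /= loop IHk. Qed.

(** Walking through the digits of a unary number: [I] is an invariant between
    the slots before and after any part of the run. *)
Lemma run_elim q (I : (slot -> R) -> (slot -> R) -> Prop) k prev d ls es :
  starts (q, true) = false ->
  (forall e, I e e) -> (forall e2 e1 e3, I e1 e2 -> I e2 e3 -> I e1 e3) ->
  (forall e1 e2 d, allowed e1 e2 d (q, true) -> I e1 e2) ->
  along prev d (nseq k (q, true) ++ (q, false) :: ls) es ->
  exists mid cur es', [/\ I prev mid, cur Zero = z,
    allowed mid cur (d + k) (q, false) &
    along cur (if starts (q, false) then 0%N else (d + k).+1) ls es'].
Proof.
move=> nst Irefl Itrans Istep; elim: k prev d es => [|k IHk] prev d es.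
  by case/along_cons=> cur [es' [cz a h]]; exists prev, cur, es'; rewrite addn0.
case/along_cons=> e1 [es1 [e1z a1]]; rewrite nst => /IHk.
case=> mid [cur [es' [Imid cz a h]]]; exists mid, cur, es'; rewrite -addSnnS.
by split=> //; apply: Itrans Imid; apply: Istep a1.
Qed.

(** All the positions of a run may repeat the slots of the preceding one. *)
Lemma run_intro q k prev d ls :
  starts (q, true) = false -> prev Zero = z ->
  (forall d, allowed prev prev d (q, true)) ->
  (exists es, along prev (d + k) ((q, false) :: ls) es) ->
  exists es, along prev d (nseq k (q, true) ++ (q, false) :: ls) es.
Proof.
move=> nst pz keep; elim: k d => [|k IHk] d; first by rewrite addn0.
move=> cont; apply: (along_consI pz (keep d)); rewrite nst.
by apply: IHk; rewrite addSnnS.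
Qed.

Definition env (x up upr dn dnr : R) (s : slot) : R :=
  match s with
  | Zero => z | Var => x | Up => up | UpR => upr | Dn => dn | DnR => dnr
  | _ => 0
  end.

Ltac lmi_simpl := rewrite /allowed /= ?lmiE /=.

Lemma enc_seq_cons (A : Type) (enc : A -> seq bool) x xs w :
  enc_seq enc (x :: xs) ++ w = true :: enc x ++ (enc_seq enc xs ++ w).
Proof. by rewrite /enc_seq /= -!catA. Qed.

Local Notation continues w :=
  (forall prev d, exists es, along prev d (annotate PList w) es).

Lemma max_elim prev d n (x0 : 'I_n) xs w es :
  along prev d (annotate PTag (enc_constraint (LeMax x0 xs) ++ w)) es ->
  G Gvar x0 <= \sum_(x <- xs) G Gvar x /\
  exists prev' d' es', along prev' d' (annotate PList w) es'.
Proof.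
rewrite /= -catA annotate_unary //= => /along_cons[e0 [es0 [_ _]]] /=.
move=> /(run_elim (I := fun _ _ => True))[] // mid [cur [es1 [_ _]]].
lmi_simpl => -[le_x0 _]; move: (_.+1) => d1 h.
suff [le_cur cont] : cur Up <= \sum_(x <- xs) G Gvar x /\
    exists prev' d' es', along prev' d' (annotate PList w) es'.
  by split=> //; apply: le_trans le_x0 le_cur.
elim: xs cur d1 es1 h {le_x0} => [|x xs IHxs] cur d1 es1.
  case/along_cons=> e1 [es2 [_]]; lmi_simpl => -[le0 _] h.
  by split=> //; exists e1, d1.+1, es2.
rewrite enc_seq_cons /= => /along_cons[e1 [es2 [_]]].
lmi_simpl => -[le1 _]; rewrite annotate_unary //.
move=> /(run_elim (I := fun e1 e2 => e1 Up <= e2 Up))[] //.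
- by move=> e2 e1' e3; apply: le_trans.
- by move=> e1' e2 d2; lmi_simpl => -[].
move=> mid' [cur' [es3 [le2 _]]]; lmi_simpl => -[le3 _].
case/IHxs=> le4 cont; split=> //; rewrite ?big_cons.
by apply: le_trans le1 (le_trans le2 (le_trans le3 _)); rewrite addrC lerD2l.
Qed.

Lemma max_intro n (x0 : 'I_n) (xs : seq 'I_n) w :
  G Gvar x0 <= \sum_(x <- xs) G Gvar x -> continues w ->
  forall prev d, exists es,
    along prev d (annotate PTag (enc_constraint (LeMax x0 xs) ++ w)) es.
Proof.
move=> le_x0 cont prev d; rewrite /= -catA annotate_unary //=.
pose e S := env 0 S 0 0 0.
apply: (@along_consI _ _ _ _ (e (\sum_(x <- xs) G Gvar x))) => //=.
apply: run_intro => //=; apply: (@along_consI _ _ _ _ (e (\sum_(x <- xs) G Gvar x))) => //=.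
  by lmi_simpl.
move: (_.+1) => d1; elim: xs d1 {le_x0} => [|x xs IHxs] d1.
  apply: (@along_consI _ _ _ _ (e 0)) => //=.
  by lmi_simpl; rewrite ?big_nil.
rewrite enc_seq_cons /=.
apply: (@along_consI _ _ _ _ (e (\sum_(x <- x :: xs) G Gvar x))) => //=.
  by lmi_simpl.
rewrite annotate_unary //; apply: run_intro => //=; first by move=> d2; lmi_simpl.
apply: (@along_consI _ _ _ _ (e (\sum_(x <- xs) G Gvar x))) => //=.
by lmi_simpl; rewrite addrC.
Qed.
Lemma average_elim prev d n (x0 x1 x2 : 'I_n) w es :
  along prev d (annotate PTag (enc_constraint (LeAverage x0 x1 x2) ++ w)) es ->
  (exists a r, [/\ G Gvar x0 <= a, r <= G Gvar x1, 0 <= r, 0 <= G Gvar x2 &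
     a ^+ 2 <= r * G Gvar x2]) /\
  exists prev' d' es', along prev' d' (annotate PList w) es'.
Proof.
rewrite /= -!catA => /along_cons[e0 [es0 [_ _]]] /= /along_cons[e1 [es1 [_ _]]] /=.
rewrite annotate_unary // => /(run_elim (I := fun _ _ => True))[] //.
move=> mid1 [c1 [es2 [_ _]]]; lmi_simpl => -[le0 _]; rewrite annotate_unary //.
move=> /(run_elim (I := fun e1 e2 => e2 Var = e1 Var))[] //.
- by move=> e2 e1' e3 -> ->.
- move=> e1' e2 d2; lmi_simpl => -[h1 [h2 _]].
  by apply/eqP; rewrite eq_le h1.
move=> mid2 [c2 [es3 [v2 _]]]; lmi_simpl => -[h1 [h2 [le1 _]]].
have {h1 h2} c2v : c2 Var = mid2 Var by apply/eqP; rewrite eq_le h1.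
rewrite annotate_unary //.
move=> /(run_elim (I := fun e1 e2 => e2 Var = e1 Var /\ e2 UpR = e1 UpR))[] //.
- by move=> e2 e1' e3 [-> ->] [-> ->].
- move=> e1' e2 d2; lmi_simpl => -[h1 [h2 [h3 [h4 _]]]].
  by split; apply/eqP; rewrite eq_le ?h1 ?h3.
move=> mid3 [c3 [es4 [[v3 r3] _]]]; lmi_simpl => -[[r_ge0 x2_ge0 sq] _] h.
split; last by do 3!eexists; exact: h.
exists (mid3 Var), (mid3 UpR); split=> //; last by rewrite r3.
by rewrite v3 c2v v2.
Qed.

Lemma average_intro n (x0 x1 x2 : 'I_n) w :
  0 <= G Gvar x1 -> 0 <= G Gvar x2 ->
  G Gvar x0 ^+ 2 <= G Gvar x1 * G Gvar x2 -> continues w ->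
  forall prev d, exists es,
    along prev d (annotate PTag (enc_constraint (LeAverage x0 x1 x2) ++ w)) es.
Proof.
move=> x1_ge0 x2_ge0 sq cont prev d; rewrite /= -!catA.
pose e := env (G Gvar x0) 0 (G Gvar x1) 0 0.
apply: (@along_consI _ _ _ _ e) => //; apply: (@along_consI _ _ _ _ e) => //=.
rewrite annotate_unary //; apply: run_intro => //=.
apply: (@along_consI _ _ _ _ e) => //=; first by lmi_simpl.
rewrite annotate_unary //; apply: run_intro => //=; first by move=> d1; lmi_simpl.
apply: (@along_consI _ _ _ _ e) => //=; first by lmi_simpl.
rewrite annotate_unary //; apply: run_intro => //=; first by move=> d1; lmi_simpl.
by apply: (@along_consI _ _ _ _ e) => //=; lmi_simpl.
Qed.

(** Horner's scheme with halving: each step is a mean of two levels, that is,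
    one geometric mean. *)
Fixpoint horner_half (c rho : R) (bs : seq bool) : R :=
  if bs is b :: bs' then horner_half ((c + (if b then rho else 0)) / 2) rho bs'
  else c.

Definition bits_value (bs : seq bool) : nat :=
  foldr (fun (b : bool) n => b + n.*2)%N 0%N bs.

Lemma horner_halfE c rho bs :
  horner_half c rho bs = (c + rho * (bits_value bs)%:R) / 2 ^+ size bs.
Proof.
elim: bs c => [|b bs IH] c /=; first by rewrite mulr0 addr0 expr0 divr1.
rewrite IH natrD -muln2 natrM exprS invfM mulrA; congr (_ / _).
by case: b => /=; field.
Qed.

(** Two's complement: digits are copied up to the first 1 and flipped after it. *)
Fixpoint neg_digits (seen : bool) (bs : seq bool) : seq bool :=
  if bs is b :: bs' then (seen (+) b) :: neg_digits (seen || b) bs' else [::].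

Lemma size_neg_digits seen bs : size (neg_digits seen bs) = size bs.
Proof. by elim: bs seen => //= b bs IH seen; rewrite IH. Qed.

Lemma neg_digits_value bs : (0 < bits_value bs)%N ->
  (bits_value (neg_digits false bs) + bits_value bs = 2 ^ size bs)%N.
Proof.
have seen_value cs :
    (bits_value (neg_digits true cs) + bits_value cs).+1 = (2 ^ size cs)%N.
  elim: cs => //= b cs IH; rewrite expnS -IH.
  by case: b => /=; clear; lia.
elim: bs => //= b bs IH; case: b => /=; rewrite expnS.
  by move=> _; rewrite -(seen_value bs); clear; lia.
by rewrite add0n double_gt0 => /IH <-; clear; lia.
Qed.

Definition bounded_run (h : slot) prev cur (rho : R) bs : Prop :=
  forall c, prev h <= lev c -> cur h <= lev (horner_half c rho bs).

Lemma lev_half (m u v c1 c2 : R) : 0 <= u -> 0 <= v -> m ^+ 2 <= u * v ->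
  u <= lev c1 -> v <= lev c2 -> m <= lev ((c1 + c2) / 2).
Proof.
move=> u0 v0 muv uc vc; have := le_half u0 v0 muv uc vc.
by congr (_ <= pow2 _); field.
Qed.

Definition up_ref (s : bool) : slot := if s then Neg else Pos.
Definition dn_ref (s : bool) : slot := if s then Pos else Neg.

(** The reference is available at the end of the numerator only, once the
    offset gives its length; the inequalities between successive [UpR] carry the
    bound back to the digits. *)
Lemma numerator_elim s bs prev d w es :
  along prev d (annotate (PNum s) (enc_seq enc_bool bs ++ w)) es ->
  prev UpR <= G (up_ref s) (d + (size bs).*2) /\
  prev DnR <= G (dn_ref s) (d + (size bs).*2) /\
  exists cur d' es', [/\ cur Var = prev Var,
    forall rho, G (up_ref s) (d + (size bs).*2) <= lev rho ->
      bounded_run Up prev cur rho bs,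
    forall rho, G (dn_ref s) (d + (size bs).*2) <= lev rho ->
      bounded_run Dn prev cur rho bs &
    along cur d' (annotate (PDen false) w) es'].
Proof.
elim: bs prev d es => [|b bs IH] prev d es.
  rewrite /= addn0 => /along_cons[cur [es1 [_]]]; lmi_simpl.
  move=> [v1 [v2 [u [dn [ur [dr [uref [dref _]]]]]]]] h.
  split; first exact: le_trans ur uref.
  split; first exact: le_trans dr dref.
  exists cur, d.+1, es1; split=> //.
  - by apply/eqP; rewrite eq_le v1.
  - by move=> rho _ c; apply: le_trans.
  - by move=> rho _ c; apply: le_trans.
rewrite enc_seq_cons /= => /along_cons[e1 [es1 [_]]]; lmi_simpl.
move=> [v1 [v2 [u1 [dn1 [ur1 [dr1 _]]]]]] /along_cons[e2 [es2 [e2z]]]; lmi_simpl.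
move=> [v3 [v4 [ur2 [dr2 [[u2 u3 u4] [[dn2 dn3 dn4] _]]]]]] /IH.
rewrite !addSnnS -!doubleS => -[urf [drf [cur [d' [es' [cv bu bd h]]]]]].
have e2v : e2 Var = prev Var.
  apply/eqP; rewrite eq_le; apply/andP; split.
    exact: le_trans v3 v1.
  exact: le_trans v2 v4.
split; first by apply: le_trans ur1 (le_trans ur2 urf).
split; first by apply: le_trans dr1 (le_trans dr2 drf).
exists cur, d', es'; split=> //; first by rewrite cv.
- move=> rho le_rho c le_c /=; apply: bu => //.
  apply: (lev_half u2 u3 u4); first exact: le_trans u1 le_c.
  by case: (b); rewrite ?e2z //; apply: le_trans urf le_rho.
- move=> rho le_rho c le_c /=; apply: bd => //.
  apply: (lev_half dn2 dn3 dn4); first exact: le_trans dn1 le_c.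
  by case: (b); rewrite ?e2z //; apply: le_trans drf le_rho.
Qed.

(** The level [xi] is any upper bound, as [prev Var] could vanish at this point. *)
Lemma denominator_elim seen bs prev d w es :
  along prev d (annotate (PDen seen) (enc_seq enc_bool bs ++ w)) es ->
  [/\ forall xi c, prev Var <= lev xi -> prev Up <= lev c ->
        prev Var <= lev (horner_half c xi (neg_digits seen bs)),
      forall xi c, prev Var <= lev xi -> prev Dn <= lev c ->
        z <= lev (horner_half c xi bs) &
      exists prev' d' es', along prev' d' (annotate PList w) es'].
Proof.
elim: bs seen prev d es => [|b bs IH] seen prev d es.
  case/along_cons=> cur [es1 [cz]]; lmi_simpl => -[le_u [le_d _]] h.
  split=> [xi c _|xi c _|]; first exact: le_trans le_u.
    by apply: le_trans; rewrite -cz.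
  by do 3!eexists; exact: h.
rewrite enc_seq_cons /= => /along_cons[e1 [es1 [_]]]; lmi_simpl.
move=> [v1 [v2 [u1 [dn1 _]]]] /along_cons[e2 [es2 [e2z]]]; lmi_simpl.
move=> [v3 [v4 [[u2 u3 u4] [[dn2 dn3 dn4] _]]]] /IH.
have e2v : e2 Var = prev Var.
  apply/eqP; rewrite eq_le; apply/andP; split.
    exact: le_trans v3 v1.
  exact: le_trans v2 v4.
rewrite e2v => -[up dn cont]; split=> // xi c le_x le_c /=.
- apply: up => //; apply: (lev_half u2 u3 u4); first exact: le_trans u1 le_c.
  by case: (seen (+) b); rewrite ?e2z ?e2v.
- apply: dn => //; apply: (lev_half dn2 dn3 dn4); first exact: le_trans dn1 le_c.
  by case: (b); rewrite ?e2z ?e2v.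
Qed.

Lemma bits_of_natK n : bits_value (bits_of_nat n) = n.
Proof.
have pos_value p : bits_value (bits_of_pos p) = nat_of_pos p.
  by elim: p => //= p ->; rewrite -mul2n NatTrec.doubleE -?mul2n.
rewrite /bits_of_nat -[RHS]bin_of_natK; case: (bin_of_nat n) => //= p.
Qed.

Lemma lt_bits_value bs : (bits_value bs < 2 ^ size bs)%N.
Proof.
elim: bs => //= b bs IH; rewrite expnS.
by case: b; move: IH; clear; lia.
Qed.

Definition numer (c : rat) : R := (numq c)%:~R.
Definition denom (c : rat) : R := (denq c)%:~R.

Lemma enc_rat_cat c w :
  enc_rat c ++ w = (numq c < 0) :: enc_seq enc_bool (bits_of_nat `|numq c|) ++
    (enc_seq enc_bool (bits_of_nat `|denq c|) ++ w).
Proof. by rewrite /enc_rat /enc_int -!catA. Qed.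

Section Constant.

Variable E : R.

Definition num_ref (s : bool) (k : nat) : R := (-1) ^+ s * 2 ^+ k * E.

Lemma numer_horner c :
  horner_half 0 (num_ref (numq c < 0) (size (bits_of_nat `|numq c|%N)))
    (bits_of_nat `|numq c|%N) = numer c * E.
Proof.
rewrite horner_halfE bits_of_natK add0r /num_ref.
have -> : numer c = (-1) ^+ (numq c < 0)%R * `|numq c|%N%:R.
  by rewrite /numer [in LHS](intEsign (numq c)) rmorphM rmorph_sign.
by field; rewrite expf_neq0 // pnatr_eq0.
Qed.

Lemma num_refN s k : num_ref (~~ s) k = - num_ref s k.
Proof. by rewrite /num_ref; case: s => /=; ring. Qed.

Lemma horner_halfN c rho bs : horner_half (- c) (- rho) bs = - horner_half c rho bs.
Proof. by rewrite !horner_halfE mulNr -opprD mulNr. Qed.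

Lemma denom_bits c :
  [/\ (bits_value (bits_of_nat `|denq c|))%:R = denom c,
      0 < denom c &
      (bits_value (neg_digits false (bits_of_nat `|denq c|)))%:R =
      2 ^+ size (bits_of_nat `|denq c|) - denom c].
Proof.
have def_q : (`|denq c|%N%:R : R) = denom c.
  by rewrite /denom -[in RHS](absz_denq c).
rewrite bits_of_natK; split=> //.
  by rewrite /denom ltr0z denq_gt0.
have := @neg_digits_value (bits_of_nat `|denq c|).
rewrite bits_of_natK absz_gt0 denq_neq0 => /(_ isT).
move/(congr1 (fun n => n%:R : R)); rewrite natrD natrX def_q => <-.
by rewrite addrK.
Qed.

(** The lower estimate q xi >= p E holds for every level [xi] that bounds [x] from
    above. So [x] is positive, and taking for [xi] its exact level turns both
    estimates into the equation. *)
Lemma constant_elim prev d n (x0 : 'I_n) (c : rat) w es :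
  let k := size (bits_of_nat `|numq c|) in
  G Pos k.*2 <= lev (num_ref false k) -> G Neg k.*2 <= lev (num_ref true k) ->
  along prev d (annotate PTag (enc_constraint (EqConst x0 c) ++ w)) es ->
  (exists xi, G Gvar x0 = lev xi /\ denom c * xi = numer c * E) /\
  exists prev' d' es', along prev' d' (annotate PList w) es'.
Proof.
move=> k le_pos le_neg; rewrite [enc_constraint _]/= !cat_cons -catA enc_rat_cat /=.
move=> /along_cons[e0 [es0 [_ _]]] /= /along_cons[e1 [es1 [_ _]]] /=.
rewrite annotate_unary // => /(run_elim (I := fun _ _ => True))[] //.
move=> mid1 [c1 [es2 [_ _]]]; lmi_simpl => -[x1 [x2 _]].
have {x1 x2} c1x : c1 Var = G Gvar x0 by apply/eqP; rewrite eq_le x1.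
move=> /along_cons[e2 [es3 [e2z]]].
lmi_simpl => -[v1 [v2 [u0 [dn0 _]]]].
have {v1 v2} e2x : e2 Var = G Gvar x0.
  by rewrite -c1x; apply/eqP; rewrite eq_le v1.
set s := (numq c < 0); rewrite e2z in u0 dn0.
move=> /numerator_elim[_ [_ [cur [d' [es4 [curv bu bd]]]]]].
rewrite add0n -/k in bu bd.
have {}bu : bounded_run Up e2 cur (num_ref s k) (bits_of_nat `|numq c|).
  by apply: bu; case: (s).
have {}bd : bounded_run Dn e2 cur (num_ref (~~ s) k) (bits_of_nat `|numq c|).
  by apply: bd; case: (s).
have {}bu := bu 0 u0; have {}bd := bd 0 dn0.
rewrite num_refN -oppr0 horner_halfN in bd.
rewrite numer_horner in bu bd.
move=> /denominator_elim; rewrite curv e2x => -[up dn cont]; split=> //.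
set x := G Gvar x0 in up dn *; set q := denom c.
have [bits_q q_gt0 bits_negq] := denom_bits c.
set bq := bits_of_nat _ in up dn bits_q bits_negq.
have pow_gt0 : 0 < 2 ^+ size bq :> R by rewrite exprn_gt0.
have lower xi : x <= lev xi -> numer c * E <= q * xi.
  move=> /dn/(_ bd); rewrite ler_pow2 lerD2r horner_halfE bits_q.
  by rewrite pmulr_lge0 ?invr_gt0 // -/q mulrC; lra.
have upper xi : x <= lev xi ->
    x <= lev ((numer c * E + xi * (2 ^+ size bq - q)) / 2 ^+ size bq).
  by move=> /up/(_ bu); rewrite horner_halfE bits_negq size_neg_digits.
(* A nonpositive [x] is below every level, also below one that is too small. *)
have x_gt0 : 0 < x.
  rewrite ltNge; apply/negP => x_le0.
  have := lower ((numer c * E - 1) / q) (le_trans x_le0 (pow2_ge0 _)).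
  by rewrite [q * _]mulrC divfK ?gt_eqF //; lra.
have [y def_y] := pow2_total x_gt0; exists (y + T).
have x_lev : x = lev (y + T) by rewrite addrK.
split=> //; apply/eqP; rewrite eq_le lower ?x_lev // andbT.
have := upper (y + T); rewrite -x_lev lexx => /(_ isT).
rewrite [X in X <= _]x_lev ler_pow2 lerD2r ler_pdivlMr //.
by rewrite -/q; lra.
Qed.

Lemma numerator_intro s x bs c c' rho rho' w :
  (forall d, exists es,
    along (env x (lev (horner_half c rho bs)) (lev rho)
               (lev (horner_half c' rho' bs)) (lev rho')) d
      (annotate (PDen false) w) es) ->
  forall d, G (up_ref s) (d + (size bs).*2) = lev rho ->
    G (dn_ref s) (d + (size bs).*2) = lev rho' ->
  exists es, along (env x (lev c) (lev rho) (lev c') (lev rho')) d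
    (annotate (PNum s) (enc_seq enc_bool bs ++ w)) es.
Proof.
move=> cont; elim: bs c c' cont => [|b bs IH] c c' cont d up dn.
  apply: along_consI (cont _) => //; rewrite /= !addn0 in up dn; lmi_simpl.
  by rewrite -/(up_ref s) -/(dn_ref s) up dn !lexx.
rewrite enc_seq_cons /=; set e0 := env _ _ _ _ _.
apply: (@along_consI _ _ _ _ e0) => //; first by lmi_simpl; rewrite !lexx.
set e1 := env x (lev ((c + (if b then rho else 0)) / 2)) (lev rho)
  (lev ((c' + (if b then rho' else 0)) / 2)) (lev rho').
apply: (@along_consI _ _ _ _ e1) => //; last first.
  by apply: IH => //=; rewrite !addSnnS -!doubleS.
lmi_simpl; rewrite !lexx ?pow2_ge0; do !split=> //.
- by case: (b); rewrite /= pow2_ge0.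
- by apply: eq_ler; case: (b) => /=; apply: pow2_half; field.
- by case: (b); rewrite /= pow2_ge0.
- by apply: eq_ler; case: (b) => /=; apply: pow2_half; field.
Qed.

Lemma denominator_intro seen xi c ur c' dr bs w :
  continues w ->
  xi <= horner_half c xi (neg_digits seen bs) -> 0 <= horner_half c' xi bs ->
  forall d, exists es, along (env (lev xi) (lev c) ur (lev c') dr) d
    (annotate (PDen seen) (enc_seq enc_bool bs ++ w)) es.
Proof.
move=> cont; elim: bs seen c c' => [|b bs IH] seen c c' up dn d.
  apply: (@along_consI _ _ _ _ (env 0 0 0 0 0)) => //.
  by lmi_simpl; rewrite !ler_pow2 !lerD2r.
rewrite enc_seq_cons /=; set e0 := env _ _ _ _ _.
apply: (@along_consI _ _ _ _ e0) => //; first by lmi_simpl; rewrite !lexx.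
set e1 := env (lev xi) (lev ((c + (if seen (+) b then xi else 0)) / 2)) ur
  (lev ((c' + (if b then xi else 0)) / 2)) dr.
apply: (@along_consI _ _ _ _ e1) => //; last exact: IH.
lmi_simpl; rewrite !lexx ?pow2_ge0; do !split=> //.
- by case: (_ (+) _); rewrite /= pow2_ge0.
- by apply: eq_ler; case: (_ (+) _) => /=; apply: pow2_half; field.
- by case: (b); rewrite /= pow2_ge0.
- by apply: eq_ler; case: (b) => /=; apply: pow2_half; field.
Qed.

Lemma constant_intro n (x0 : 'I_n) (c : rat) xi w :
  let k := size (bits_of_nat `|numq c|) in
  G Pos k.*2 = lev (num_ref false k) -> G Neg k.*2 = lev (num_ref true k) ->
  G Gvar x0 = lev xi -> denom c * xi = numer c * E -> continues w ->
  forall prev d, exists es,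
    along prev d (annotate PTag (enc_constraint (EqConst x0 c) ++ w)) es.
Proof.
move=> k def_pos def_neg def_x def_xi cont prev d.
rewrite [enc_constraint _]/= !cat_cons -catA enc_rat_cat /=.
set s := (numq c < 0).
pose e := env (lev xi) (lev 0) (lev (num_ref s k)) (lev 0) (lev (num_ref (~~ s) k)).
apply: (@along_consI _ _ _ _ e) => //; apply: (@along_consI _ _ _ _ e) => //=.
rewrite annotate_unary //; apply: run_intro => //=.
apply: (@along_consI _ _ _ _ e) => //=; first by lmi_simpl; rewrite def_x lexx.
apply: (@along_consI _ _ _ _ e) => //=; first by lmi_simpl; rewrite !lexx.
have [bits_q q_gt0 bits_negq] := denom_bits c.
set bq := bits_of_nat `|denq c| in bits_q bits_negq *.
have pow_gt0 : 0 < 2 ^+ size bq :> R by rewrite exprn_gt0.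
apply: numerator_intro; last 2 first.
- by rewrite add0n -/k /up_ref; case: (s).
- by rewrite add0n -/k /dn_ref; case: (s).
have -> : horner_half 0 (num_ref (~~ s) k) (bits_of_nat `|numq c|) = - (numer c * E).
  by rewrite num_refN -[X in horner_half X]oppr0 horner_halfN numer_horner.
rewrite numer_horner; apply: denominator_intro => //.
  rewrite horner_halfE bits_negq size_neg_digits ler_pdivlMr //.
  by rewrite -def_xi; lra.
rewrite horner_halfE bits_q -def_xi divr_ge0 ?(ltW pow_gt0) //; lra.
Qed.
End Constant.
End LocalAnalysis.

(** * From constraints to instances *)

Section Shape.

(** The last constraints are attached to the letter [(PList, false)], so it must
    not occur before the end. *)
Definition stays q w q' :=
  all (fun l : pletter => l.1 != PList) (annotate q w) /\ foldl pnext q w = q'.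

Lemma stays_cat q w1 q1 w2 q2 :
  stays q w1 q1 -> stays q1 w2 q2 -> stays q (w1 ++ w2) q2.
Proof.
by move=> [a1 <-] [a2 <-]; rewrite /stays annotate_cat all_cat a1 a2 foldl_cat.
Qed.

Lemma stays_unary q k : q != PList -> pnext q true = q ->
  stays q (enc_unary k) (pnext q false).
Proof.
move=> nq loop; rewrite /stays -[enc_unary k]cats0 annotate_unary //.
rewrite all_cat all_nseq /= nq !orbT cats0; split=> //.
by elim: k => //= k; rewrite /enc_unary /= loop.
Qed.

Lemma stays_max n (xs : seq 'I_n) : stays PMaxList (enc_seq (@enc_ord n) xs) PList.
Proof.
elim: xs => [|x xs IH]; first by [].
rewrite -[enc_seq _ _]cats0 enc_seq_cons cats0 -cat1s.
apply: (@stays_cat _ _ PMaxItem) => //; apply: stays_cat IH.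
exact: (@stays_unary PMaxItem).
Qed.

Lemma stays_numerator s bs : stays (PNum s) (enc_seq enc_bool bs) (PDen false).
Proof.
elim: bs => [|b bs IH]; first by [].
rewrite -[enc_seq _ _]cats0 enc_seq_cons cats0 -cat1s catA.
by apply: stays_cat IH.
Qed.

Lemma stays_denominator seen bs : stays (PDen seen) (enc_seq enc_bool bs) PList.
Proof.
elim: bs seen => [|b bs IH] seen; first by [].
rewrite -[enc_seq _ _]cats0 enc_seq_cons cats0 -cat1s catA.
by apply: stays_cat (IH _).
Qed.

Lemma stays_constraint n (C : constraint n) : stays PTag (enc_constraint C) PList.
Proof.
case: C => [x0 xs|x0 x1 x2|x0 c]; rewrite /enc_constraint.
- apply: (@stays_cat _ _ PMaxLhs) => //; apply: stays_cat (stays_max xs).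
  exact: (@stays_unary PMaxLhs).
- apply: (@stays_cat _ _ PAvgLhs) => //.
  apply: (stays_cat (@stays_unary PAvgLhs x0 _ _)) => //.
  apply: (stays_cat (@stays_unary PAvgFst x1 _ _)) => //.
  exact: (@stays_unary PAvgSnd x2 _ _).
- apply: (@stays_cat _ _ PCstVar) => //.
  apply: (stays_cat (@stays_unary PCstVar x0 _ _)) => //.
  rewrite /enc_rat /enc_int -catA; apply: (@stays_cat _ _ (PNum (numq c < 0))) => //.
  apply: (stays_cat (stays_numerator _ _)); exact: stays_denominator.
Qed.

Lemma annotate_constraints n (cs : seq (constraint n)) :
  exists2 l, annotate PList (enc_seq (@enc_constraint n) cs) =
    rcons l (PList, false) & (PList, false) \notin l.
Proof.
elim: cs => [|C cs [l IH notin]]; first by exists [::].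
rewrite -[enc_seq _ _]cats0 enc_seq_cons cats0 /= annotate_cat.
have [stay ->] := stays_constraint C; rewrite IH -rcons_cat -rcons_cons.
eexists; first by [].
rewrite inE mem_cat !negb_or notin andbT /=.
by apply: contraL stay => mem; apply/negP => /allP/(_ _ mem).
Qed.

Lemma annotate_prefix n u : exists2 l,
  annotate PStart (enc_unary n ++ u) = l ++ annotate PList u &
  (PList, false) \notin l.
Proof.
case: n => [|n]; first by exists [:: (PStart, false)].
exists ((PStart, true) :: nseq n (PVars, true) ++ [:: (PVars, false)]).
  by rewrite -[enc_unary n.+1]/(true :: enc_unary n) /= annotate_unary // -catA.
by rewrite inE mem_cat mem_nseq !inE /= andbF.
Qed.

Lemma annotate_instance I : exists2 l,
  annotate PStart (enc_max_average I) = rcons l (PList, false) &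
  (PList, false) \notin l.
Proof.
rewrite /enc_max_average.
have [l1 -> notin1] := annotate_prefix (ma_vars I)
  (enc_seq (@enc_constraint _) (ma_constraints I)).
have [l2 -> notin2] := annotate_constraints (ma_constraints I).
by exists (l1 ++ l2); rewrite ?rcons_cat // mem_cat negb_or notin1.
Qed.

Lemma annotate_first u p : (p < size u)%N ->
  ((nth letter0 (annotate PStart u) p).1 == PStart) = (p == 0)%N.
Proof.
have next q b : pnext q b != PStart by case: q => //=; case: b => [] // [].
have later u' : forall q k, q != PStart -> (k < size u')%N ->
    (nth letter0 (annotate q u') k).1 != PStart.
  elim: u' => // b u' IH q [|k] nq lt_k //.
  exact: IH (next _ _) lt_k.
case: u p => // b u [|p] // lt_p.
exact: negbTE (later u (pnext PStart b) p (next _ _) lt_p).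
Qed.
End Shape.

Section Bridge.
Variables (R : realType) (v : seq pletter).
Local Notation N := (size v).
Local Notation T := (top_level R v).

Lemma along_of_positions (y : slot -> nat -> R) :
  (forall p, (p < N)%N -> y Zero p = level v 0) ->
  (forall p, (p < N)%N ->
    lmis_hold (addr_value v y p) (local_lmis (nth letter0 v p))) ->
  along T y (fun=> 0) 0 v [seq (fun s => y s p) | p <- iota 0 N].
Proof.
move=> yz hold.
suff run k m : (m + k = N)%N ->
    along T y (fun s => if m is m'.+1 then y s m' else 0) (offset v m) (drop m v)
      [seq (fun s => y s p) | p <- iota m k].
  by have := run N 0%N erefl; rewrite drop0.
elim: k m => [|k IH] m def_k; first by rewrite drop_oversize // -def_k addn0.
have lt_m : (m < N)%N by rewrite -def_k addnS ltnS leq_addr.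
rewrite (drop_nth letter0) //=; split; first exact: yz.
  rewrite /allowed (_ : local_value _ _ _ _ = addr_value v y m); first exact: hold.
  by apply: funext => -[].
by apply: (IH m.+1); rewrite addSnnS.
Qed.

Lemma positions_of_along (G : slot -> nat -> R) es :
  along T G (fun=> 0) 0 v es ->
  size es = N /\ forall p, (p < N)%N ->
    nth (fun=> 0) es p Zero = level v 0 /\
    lmis_hold (local_value G (if p is p'.+1 then nth (fun=> 0) es p' else fun=> 0)
       (nth (fun=> 0) es p) (offset v p)) (local_lmis (nth letter0 v p)).
Proof.
suff run ls es' m prev : drop m v = ls -> along T G prev (offset v m) ls es' ->
    size es' = size ls /\ forall p, (p < size ls)%N ->
    nth (fun=> 0) es' p Zero = level v 0 /\
    lmis_hold (local_value G (if p is p'.+1 then nth (fun=> 0) es' p' else prev)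
       (nth (fun=> 0) es' p) (offset v (m + p))) (local_lmis (nth letter0 ls p)).
  by apply: (run v es 0%N); rewrite drop0.
elim: ls es' m prev => [|l ls IH] [|e es'] m prev //= def_ls [ez al h].
have lt_m : (m < N)%N by rewrite ltnNge; apply/negP => /drop_oversize; rewrite def_ls.
move: def_ls; rewrite (drop_nth letter0) // => -[def_l def_ls].
have [|-> hold] := IH es' m.+1 e def_ls; first by rewrite /= def_l.
split=> // -[|p] lt_p; first by rewrite addn0.
have [ez' hold'] := hold p lt_p; split=> //; rewrite -addSnnS.
by case: p lt_p {ez'} hold'.
Qed.

Definition lmi_addrs (C : lmi) : seq addr :=
  match C with Lin ps ms => ps ++ ms | Geo m u w => [:: m; u; w] end.

Lemma lmis_hold_ext (P : pred addr) (mu mu' : addr -> R) Cs :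
  (forall a, P a -> mu a = mu' a) -> all (fun C => all P (lmi_addrs C)) Cs ->
  lmis_hold mu Cs -> lmis_hold mu' Cs.
Proof.
move=> eq_mu; have eq_sum s : all P s -> \sum_(a <- s) mu a = \sum_(a <- s) mu' a.
  elim: s => [|a s IH] /=; first by rewrite !big_nil.
  by case/andP=> /eq_mu aP /IH sP; rewrite !big_cons aP sP.
elim: Cs => //= C Cs IH /andP[allC /IH{}IH] [hC /IH hCs]; split=> //.
case: C allC hC => [ps ms|m u w] /=.
  by rewrite all_cat => /andP[/eq_sum<- /eq_sum<-].
by case/and4P=> /eq_mu<- /eq_mu<- /eq_mu<-.
Qed.

Definition is_local (s : slot) : bool :=
  match s with Var | Up | UpR | Dn | DnR => true | _ => false end.

Definition local_addr (a : addr) : bool :=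
  match a with
  | One => false
  | Here s => is_local s || (s == Zero)
  | Left s => is_local s
  | Ref s => s \in [:: Gvar; Pos; Neg]
  end.

(** This separation allows common and local slots to be filled independently. *)
Lemma local_lmis_addrs l : all (fun C => all local_addr (lmi_addrs C)) (local_lmis l).
Proof. by case: l => -[|||||||||||||[]|[]|[]|[]|] []. Qed.

Hypothesis N_gt1 : (1 < N)%N.
Hypothesis v_first : forall p, (p < N)%N ->
  ((nth letter0 v p).1 == PStart) = (p == 0)%N.
Hypothesis v_last : forall p, (p < N)%N ->
  (nth letter0 v p == (PList, false)) = (p == N.-1)%N.

Definition globals (X : nat -> R) (s : slot) (p : nat) : R :=
  if s is Gvar then X p else common_value R v s p.

Lemma feasible_of_along (X : nat -> R) :
  (exists es, along T (globals X) (fun=> 0) 0 v es) ->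
  exists y : slot -> nat -> R, forall p, (p < N)%N ->
    lmis_hold (addr_value v y p) (lmis (nth letter0 v p)).
Proof.
case=> es /positions_of_along[_ hold].
pose y s p := if is_local s then nth (fun=> 0) es p s else globals X s p.
exists y => p lt_p; apply/lmis_hold_cat; split.
  by apply: common_feasible => // -[].
have [ez] := hold p lt_p; apply: lmis_hold_ext (local_lmis_addrs _) => a.
case: a => [|s|s|s] //=.
- by case/orP=> [s_local|/eqP->]; rewrite /y ?s_local.
- by rewrite /y => ->; case: (p).
- by rewrite !inE => /or3P[]/eqP->.
Qed.
End Bridge.

Section RealSemantics.
Variables (R : realType) (I : max_average).

Let w := enc_max_average I.
Let v := annotate PStart w.
Local Notation N := (size v).
Local Notation T := (top_level R v).

Definition unit_level : R := 2 ^+ (N.-1)./2.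
Local Notation E := unit_level.

(** What is extracted from a feasible point. *)
Definition weak_sem (n : nat) (X : nat -> R) (C : constraint n) : Prop :=
  match C with
  | LeMax x0 xs => X x0 <= \sum_(x <- xs) X x
  | LeAverage x0 x1 x2 => exists a r,
      [/\ X x0 <= a, r <= X x1, 0 <= r, 0 <= X x2 & a ^+ 2 <= r * X x2]
  | EqConst x0 c => exists xi, X x0 = level v xi /\ denom R c * xi = numer R c * E
  end.

(** What is used to build a feasible point. *)
Definition strong_sem (n : nat) (X : nat -> R) (C : constraint n) : Prop :=
  match C with
  | LeMax x0 xs => X x0 <= \sum_(x <- xs) X x
  | LeAverage x0 x1 x2 =>
      [/\ 0 <= X x1, 0 <= X x2 & X x0 ^+ 2 <= X x1 * X x2]
  | EqConst x0 c => exists xi, X x0 = level v xi /\ denom R c * xi = numer R c * E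
  end.

Lemma size_instance : N = size w.
Proof.
by rewrite /v; elim: (w) PStart => //= b u IH q; rewrite IH.
Qed.

Lemma instance_gt1 : (1 < N)%N.
Proof.
rewrite size_instance /w /enc_max_average /enc_unary /enc_seq !size_cat.
by rewrite size_rcons /=; clear; lia.
Qed.

Lemma instance_first p : (p < N)%N ->
  ((nth letter0 v p).1 == PStart) = (p == 0)%N.
Proof. by rewrite size_instance; apply: annotate_first. Qed.

Lemma instance_last p : (p < N)%N ->
  (nth letter0 v p == (PList, false)) = (p == N.-1)%N.
Proof.
rewrite /v /w; have [l -> notin] := annotate_instance I.
rewrite !size_rcons ltnS nth_rcons /=.
case: (ltngtP p (size l)) => [lt_p _|//|_ _]; last by rewrite eqxx.
by apply: contraNF notin => /eqP<-; apply: mem_nth.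
Qed.

Lemma ref_level_unit k : (k.*2 < N)%N -> ref_level R v k.*2 = num_ref E false k.
Proof.
move=> lt_k; rewrite /ref_level /num_ref expr0 mul1r.
have -> : 2 ^+ N.-1 = 2 ^+ k * E * 2 ^+ (N - k.*2)./2 :> R.
  by rewrite -!exprD; congr (_ ^+ _); clear - lt_k; lia.
by rewrite mulfK // expf_neq0 // pnatr_eq0.
Qed.

Lemma num_ref_true k : num_ref E true k = - num_ref E false k.
Proof. by rewrite /num_ref /= expr0 expr1; ring. Qed.

Lemma prefix_elim n prev d u (G : slot -> nat -> R) es :
  along T G prev d (annotate PStart (enc_unary n ++ u)) es ->
  exists prev' d' es', along T G prev' d' (annotate PList u) es'.
Proof.
case: n => [|n]; first by case/along_cons=> e [es' [_ _ h]]; exists e, d.+1, es'.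
rewrite -[annotate _ _]/((PStart, true) :: annotate PVars (enc_unary n ++ u)).
case/along_cons=> e [es1 [_ _]]; rewrite annotate_unary //.
move=> /(run_elim (I := fun _ _ => True))[] //.
by move=> _ [e' [es2 [_ _ _ h]]]; do 3!eexists; exact: h.
Qed.

Lemma prefix_intro n prev d u (G : slot -> nat -> R) :
  (forall prev' d', exists es, along T G prev' d' (annotate PList u) es) ->
  exists es, along T G prev d (annotate PStart (enc_unary n ++ u)) es.
Proof.
move=> cont; pose e := env T 0 0 0 0 0.
case: n => [|n]; first by apply: (along_consI (cur := e)).
rewrite -[annotate _ _]/((PStart, true) :: annotate PVars (enc_unary n ++ u)).
apply: (along_consI (cur := e)) => //; rewrite annotate_unary //.
by apply: run_intro => //=; apply: (along_consI (cur := e)) => //=.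
Qed.

Lemma size_enc_bits (bs : seq bool) :
  size (enc_seq enc_bool bs) = (size bs).*2.+1.
Proof. by elim: bs => //= b bs; rewrite /enc_seq /= => ->. Qed.

Lemma size_constraint_bits n (x0 : 'I_n) c :
  ((size (bits_of_nat `|numq c|)).*2 < size (enc_constraint (EqConst x0 c)))%N.
Proof.
rewrite /enc_constraint /enc_rat /enc_int /enc_nat 4!size_cat !size_enc_bits /=.
by clear; lia.
Qed.

Lemma constraints_elim (G : slot -> nat -> R) n (cs : seq (constraint n)) :
  (forall k, (k.*2 < N)%N -> G Pos k.*2 <= level v (num_ref E false k)) ->
  (forall k, (k.*2 < N)%N -> G Neg k.*2 <= level v (num_ref E true k)) ->
  (size (enc_seq (@enc_constraint n) cs) <= N)%N ->
  forall prev d es,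
  along T G prev d (annotate PList (enc_seq (@enc_constraint n) cs)) es ->
  foldr and True [seq weak_sem (G Gvar) C | C <- cs].
Proof.
move=> le_pos le_neg; elim: cs => [//|C cs IH] le_N prev d es.
rewrite -[enc_seq _ _]cats0 enc_seq_cons cats0 in le_N *.
rewrite /= size_cat in le_N.
move=> /along_cons[e1 [es1 [_ _]]] /= h.
suff [semC [p' [d' [es' h']]]] : weak_sem (G Gvar) C /\ exists prev' d' es',
    along T G prev' d' (annotate PList (enc_seq (@enc_constraint n) cs)) es'.
  by split=> //; apply: IH h'; apply: leq_trans (leq_addl _ _) (ltnW le_N).
case: C h le_N => [x0 xs|x0 x1 x2|x0 c] h le_N.
- exact: max_elim h.
- exact: average_elim h.
- have lt_k := leq_trans (size_constraint_bits x0 c)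
    (leq_trans (leq_addr _ _) (ltnW le_N)).
  by apply: constant_elim h; [apply: le_pos|apply: le_neg].
Qed.

Lemma constraints_intro (G : slot -> nat -> R) n (cs : seq (constraint n)) :
  (forall k, (k.*2 < N)%N -> G Pos k.*2 = level v (num_ref E false k)) ->
  (forall k, (k.*2 < N)%N -> G Neg k.*2 = level v (num_ref E true k)) ->
  (size (enc_seq (@enc_constraint n) cs) <= N)%N ->
  foldr and True [seq strong_sem (G Gvar) C | C <- cs] ->
  forall prev d, exists es,
  along T G prev d (annotate PList (enc_seq (@enc_constraint n) cs)) es.
Proof.
move=> le_pos le_neg; pose e := env T 0 0 0 0 0.
elim: cs => [|C cs IH].
  by move=> _ _ prev d; apply: (along_consI (cur := e)) => //; exists [::].
rewrite -[enc_seq _ _]cats0 enc_seq_cons cats0 [size _]/= size_cat.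
move=> le_N /= [semC /IH cont] prev d.
have {}cont := cont (leq_trans (leq_addl _ _) (ltnW le_N)).
apply: (along_consI (cur := e)) => //=.
case: C semC le_N => [x0 xs|x0 x1 x2|x0 c] /= semC le_N.
- exact: max_intro.
- by case: semC => *; apply: average_intro.
- have lt_k := leq_trans (size_constraint_bits x0 c)
    (leq_trans (leq_addr _ _) (ltnW le_N)).
  case: semC => xi [def_x def_xi].
  exact (constant_intro (le_pos _ lt_k) (le_neg _ lt_k) def_x def_xi cont _ _).
Qed.

Lemma reduction_elim : sdp_feasible R (reduction I) ->
  exists X : nat -> R, foldr and True [seq weak_sem X C | C <- ma_constraints I].
Proof.
case/sdp_of_feasible => y hold.
have common p lt_p := proj1 (proj1 (lmis_hold_cat _ _ _) (hold p lt_p)).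
have bounds := common_bounds instance_gt1 instance_first instance_last common.
have local p lt_p := proj2 (proj1 (lmis_hold_cat _ _ _) (hold p lt_p)).
have yz p (lt_p : (p < N)%N) : y Zero p = level v 0 by case: (bounds p lt_p).
have := along_of_positions yz local; rewrite {2}/v /w /enc_max_average.
case/prefix_elim=> prev [d [es h]]; exists (y Gvar).
apply: constraints_elim h => [k lt_k|k lt_k|].
- by rewrite -ref_level_unit //; case: (bounds _ lt_k).
- by rewrite num_ref_true -ref_level_unit //; case: (bounds _ lt_k).
- by rewrite size_instance /w /enc_max_average size_cat leq_addl.
Qed.

Lemma reduction_intro (X : nat -> R) :
  foldr and True [seq strong_sem X C | C <- ma_constraints I] ->
  sdp_feasible R (reduction I).
Proof.
move=> sem; apply/sdp_of_feasible.
apply: (feasible_of_along instance_gt1 instance_first instance_last (X := X)).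
rewrite {2}/v /w /enc_max_average; apply: prefix_intro => prev d.
apply: constraints_intro sem _ _ => [k lt_k|k lt_k|].
- by rewrite /= ref_level_unit.
- by rewrite /= num_ref_true ref_level_unit.
- by rewrite size_instance /w /enc_max_average size_cat leq_addl.
Qed.

End RealSemantics.

(** * Rounding a nearly feasible linear system *)

(** Expanding the product of the row sums yields one nonnegative term for each
    map from rows to columns; permutations account for the determinant. *)
Lemma det_le_row_norms (r : nat) (A : 'M[int]_r) :
  `|\det A| <= \prod_i \sum_j `|A i j|.
Proof.
rewrite bigA_distr_bigA /= /determinant; apply: le_trans (ler_norm_sum _ _ _) _.
pose F (s : 'S_r) : {ffun 'I_r -> 'I_r} := pval s.
rewrite (eq_bigr (fun s : 'S_r => \prod_i `|A i (F s i)|)) => [|s _]; last first.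
  by rewrite normrM normr_sign mul1r normr_prod; apply: eq_bigr => i _; rewrite /F pvalE.
rewrite -(big_imset (fun f : {ffun 'I_r -> 'I_r} => \prod_i `|A i (f i)|)) /=; last first.
  by move=> s t _ _ /val_inj.
rewrite [leRHS](bigID (mem (F @: setT))) /= -[leLHS]addr0 lerD //.
  rewrite le_eqVlt; apply/orP; left; apply/eqP; apply: eq_bigl => f.
  by apply/imsetP/imsetP => -[s _ ->]; exists s; rewrite ?inE.
by apply: sumr_ge0 => f _; apply: prodr_ge0.
Qed.

Section Rounding.

Variables (R : realType) (m n : nat) (M : 'M[int]_(m, n)) (h : 'cV[int]_m).
Variables (eqr : pred 'I_m) (o : 'I_m) (j0 : 'I_n).
Hypothesis Mo : forall j, M o j = - (j == j0)%:R.
Hypothesis ho : h o 0 = 0.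

Definition lp_feasible (F : numDomainType) (z : 'cV[F]_n) : Prop :=
  forall i, (map_mx intr M *m z) i 0 <= (h i 0)%:~R
         /\ (eqr i -> (map_mx intr M *m z) i 0 = (h i 0)%:~R).

Let MR : 'M[R]_(m, n) := map_mx intr M.
Let tight (z : 'cV[R]_n) (i : 'I_m) : bool := (MR *m z) i 0 == (h i 0)%:~R.
Let Tm (z : 'cV[R]_n) : 'M[R]_(m, n) :=
  \matrix_(i, j) (if tight z i then MR i j else 0).

Lemma row_tight z i : tight z i -> row i (Tm z) = row i MR.
Proof. by move=> ti; apply/rowP => j; rewrite !mxE ti. Qed.

Lemma row_loose z i : ~~ tight z i -> row i (Tm z) = 0.
Proof. by move=> /negPf ti; apply/rowP => j; rewrite !mxE ti. Qed.

Lemma row_o (F : numDomainType) (z : 'cV[F]_n) : (map_mx intr M *m z) o 0 = - z j0 0.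
Proof.
rewrite mxE (bigD1 j0) //= big1 ?addr0 => [|j ne_j].
  by rewrite mxE Mo eqxx rmorphN1 mulN1r.
by rewrite mxE Mo (negPf ne_j) oppr0 rmorph0 mul0r.
Qed.

(** Move along a direction that keeps the tight rows tight and does not increase
    coordinate [j0], until a new row, outside the span, becomes tight. *)
Lemma tighten z : lp_feasible z -> ~~ (MR <= Tm z)%MS ->
  exists z', [/\ lp_feasible z', z' j0 0 <= z j0 0 & (\rank (Tm z) < \rank (Tm z'))%N].
Proof.
move=> fz; rewrite submxE => /matrix0Pn[i [k nz]].
pose v0 := cokermx (Tm z) *m delta_mx k (0 : 'I_1).
have Tv0 : Tm z *m v0 = 0 by rewrite mulmxA mulmx_coker mul0mx.
(* The sign is chosen so that coordinate [j0] does not increase while the value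
   of some row does: row [o] if coordinate [j0] changes, row [i] otherwise. *)
have [v [Tv j0v [i1 pos1]]] : exists v : 'cV[R]_n,
    [/\ Tm z *m v = 0, v j0 0 <= 0 & exists i, 0 < (MR *m v) i 0].
  have nz0 : (MR *m v0) i 0 != 0 by rewrite mulmxA -colE mxE.
  have [v0j|v0j|v0j] := ltgtP (v0 j0 0) 0.
  - by exists v0; split; rewrite ?(ltW v0j) //; exists o; rewrite row_o oppr_gt0.
  - exists (- v0); rewrite mulmxN Tv0 oppr0; split=> //.
      by rewrite mxE oppr_le0 ltW.
    by exists o; rewrite row_o mxE opprK.
  - have [pos|neg|eq0] := ltgtP 0 ((MR *m v0) i 0).
    + by exists v0; rewrite v0j; split=> //; exists i.
    + exists (- v0); rewrite mulmxN Tv0 oppr0 mxE v0j oppr0; split=> //.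
      by exists i; rewrite mulmxN mxE oppr_gt0.
    + by rewrite -eq0 eqxx in nz0.
have tight_v l : tight z l -> (MR *m v) l 0 = 0.
  move=> tl; have : row l (Tm z *m v) = 0 by rewrite Tv row0.
  rewrite row_mul row_tight // -row_mul => /rowP/(_ 0).
  by rewrite !mxE.
pose slack l := (h l 0)%:~R - (MR *m z) l 0.
pose ratio l := slack l / (MR *m v) l 0.
pose P := [pred l | 0 < (MR *m v) l 0].
pose i2 := [arg min_(l < i1 | P l) ratio l]%O.
have [P2 min2] : P i2 /\ forall l, P l -> ratio i2 <= ratio l.
  by rewrite /i2; case: arg_minP.
have slack_ge0 l : 0 <= slack l by rewrite subr_ge0; case: (fz l).
have tau_ge0 : 0 <= ratio i2 by rewrite divr_ge0 // ltW.
pose z' := z + ratio i2 *: v.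
have rowz' l : (MR *m z') l 0 = (MR *m z) l 0 + ratio i2 * (MR *m v) l 0.
  by rewrite mulmxDr -scalemxAr !mxE.
have tight' l : tight z l -> tight z' l.
  by move=> tl; rewrite /tight rowz' tight_v // mulr0 addr0.
have tight2 : tight z' i2.
  have nz2 : (MR *m v) i2 0 != 0 by rewrite gt_eqF.
  by rewrite /tight rowz' /ratio divfK // /slack addrC subrK.
exists z'; split.
- move=> l; rewrite -/MR rowz'; have [le_l eq_l] := fz l; split; last first.
    move=> /eq_l el; rewrite tight_v ?mulr0 ?addr0 //; exact/eqP.
  have [neg|pos] := leP ((MR *m v) l 0) 0.
    rewrite -[leRHS]addr0 lerD //; exact: mulr_ge0_le0.
  rewrite -lerBrDl -ler_pdivlMr //; exact: min2.
- by rewrite !mxE gerDl mulr_ge0_le0.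
- apply: rank_ltmx; apply/andP; split.
    apply/row_subP => l; case: (boolP (tight z l)) => tl.
      rewrite row_tight // -(row_tight (tight' _ tl)); exact: row_sub.
    by rewrite row_loose // sub0mx.
  apply/negP => sub; have : (row i2 MR <= Tm z)%MS.
    by rewrite -(row_tight tight2); apply: submx_trans sub; apply: row_sub.
  case/submxP => D rowE; have : (row i2 MR *m v) 0 0 = 0.
    by rewrite rowE -mulmxA Tv mulmx0 mxE.
  by rewrite -row_mul mxE => e0; move: P2; rewrite /= e0 ltxx.
Qed.

Lemma tightest z : lp_feasible z -> exists z',
  [/\ lp_feasible z', z' j0 0 <= z j0 0 & (MR <= Tm z')%MS].
Proof.
have [d] := ubnP (m - \rank (Tm z)); elim: d z => // d IH z le_d fz.
have [sub|nsub] := boolP (MR <= Tm z)%MS; first by exists z.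
have [z1 [fz1 le1 rk1]] := tighten fz nsub.
have [||z2 [fz2 le2 sub2]] := IH z1 => //.
  have := rank_leq_row (Tm z1); move: le_d rk1; clear; lia.
by exists z2; split=> //; apply: le_trans le2 le1.
Qed.

Variable wt : 'I_m -> nat.
Hypothesis wt_gt0 : forall i, (0 < wt i)%N.
Hypothesis row_norm : forall i, \sum_j `|M i j| <= (wt i)%:Z.

(** Where the tight rows span all the rows, the value of each row is determined
    by the right-hand sides of the tight rows. Hence every solution of a maximal
    independent set of tight rows is feasible, for instance the one given by
    Cramer's rule for a nonzero maximal minor. *)
Lemma lp_rounding (z : 'cV[R]_n) : lp_feasible z ->
  z j0 0 * (\prod_i wt i)%N%:R < 1 ->
  exists2 z' : 'cV[rat]_n, lp_feasible z' & z' j0 0 = 0.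
Proof.
move=> /tightest[y [fy le_y sub]] small.
set r := \rank (Tm y); pose f : 'I_r -> 'I_m := maxrankfun (Tm y).
have f_inj : injective f by exact: maxrankfun_inj.
have free : row_free (rowsub f (Tm y)) by exact: maxrowsub_free.
have f_tight k : tight y (f k).
  apply: contraT => loose; have := row_free_inj free.
  move=> /(_ _ (delta_mx 0 k : 'rV_r) 0); rewrite mul0mx -rowE row_rowsub.
  rewrite row_loose // => /(_ erefl)/rowP/(_ k)/eqP.
  by rewrite !mxE !eqxx oner_eq0.
have rowsubE : rowsub f (Tm y) = rowsub f MR.
  by apply/matrixP => k j; rewrite !mxE f_tight.
have subf : (MR <= rowsub f MR)%MS.
  rewrite -rowsubE; apply: submx_trans sub _; by rewrite eq_maxrowsub.
rewrite rowsubE in free.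
have full : row_full (rowsub f MR)^T by rewrite /row_full mxrank_tr.
pose g : 'I_r -> 'I_n := fullrankfun full.
have g_inj : injective g by exact: fullrankfun_inj.
pose S : 'M[int]_r := mxsub f g M.
have detS : \det S != 0.
  have : rowsub g (rowsub f MR)^T \in unitmx by exact: fullrowsub_unit.
  have -> : rowsub g (rowsub f MR)^T = (map_mx intr S)^T.
    by apply/matrixP => k j; rewrite !mxE.
  by rewrite unitmxE det_tr det_map_mx unitfE intr_eq0.
have le_detS : `|\det S| <= (\prod_i wt i)%N%:Z.
  apply: le_trans (det_le_row_norms S) _.
  have le_row k : \sum_j `|S k j| <= (wt (f k))%:Z.
    apply: le_trans (row_norm (f k)).
    rewrite (eq_bigr (fun j => `|M (f k) (g j)|)) => [|j _]; last by rewrite mxE.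
    rewrite -(big_imset (fun j => `|M (f k) j|)) /=; last by move=> ? ? _ _ /g_inj.
    rewrite [leRHS](bigID (mem (g @: 'I_r))) /= -[leLHS]addr0 lerD //.
    exact: sumr_ge0.
  apply: (@le_trans _ _ (\prod_k (wt (f k))%:Z)).
    by apply: ler_prod => k _; rewrite sumr_ge0 //= le_row.
  rewrite -(big_morph Posz PoszM (erefl _ : Posz 1 = 1)) lez_nat.
  rewrite -(big_imset wt) /=; last by move=> ? ? _ _ /f_inj.
  rewrite [leqRHS](bigID (mem (f @: 'I_r))) /= leq_pmulr //.
  exact: prodn_gt0.
pose hS : 'cV[int]_r := \col_k h (f k) 0.
pose zS := \adj S *m hS.
have S_zS : S *m zS = \det S *: hS by rewrite mulmxA mul_mx_adj mul_scalar_mx.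
pose z' : 'cV[rat]_n := \col_j \sum_k (if g k == j then (zS k 0)%:~R / (\det S)%:~R else 0).
have detQ : (\det S)%:~R != 0 :> rat by rewrite intr_eq0.
have row_f k : (map_mx intr M *m z') (f k) 0 = (h (f k) 0)%:~R.
  rewrite mxE; transitivity (\sum_l (M (f k) (g l))%:~R * ((zS l 0)%:~R / (\det S)%:~R) : rat).
    under eq_bigr do rewrite !mxE mulr_sumr.
    rewrite exchange_big; apply: eq_bigr => l _.
    rewrite (bigD1 (g l)) //= eqxx big1 ?addr0 // => j ne_j.
    by rewrite eq_sym (negPf ne_j) mulr0.
  under eq_bigr do rewrite mulrA -rmorphM.
  rewrite -mulr_suml -rmorph_sum; apply: (canLR (mulfK detQ)).
  rewrite -rmorphM; congr (_%:~R); have := congr1 (fun B : 'cV_r => B k 0) S_zS.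
  rewrite [LHS]mxE [RHS]mxE [hS _ _]mxE mulrC => <-.
  by apply: eq_bigr => l _; rewrite [S k l]mxE.
have row_y i : ratr ((map_mx intr M *m z') i 0) = (MR *m y) i 0.
  have /submxP[D rowE] : (row i MR <= rowsub f MR)%MS.
    exact: submx_trans (row_sub _ _) subf.
  pose zR : 'cV[R]_n := map_mx ratr z'.
  have castE l : ratr ((map_mx intr M *m z') l 0) = (MR *m zR) l 0.
    rewrite [in LHS]mxE [RHS]mxE rmorph_sum; apply: eq_bigr => j _.
    by rewrite rmorphM [MR _ _]mxE [zR _ _]mxE [X in ratr X * _]mxE /= ratr_int.
  have rowi (u : 'cV[R]_n) : (MR *m u) i 0 = (D *m (rowsub f MR *m u)) 0 0.
    by rewrite mulmxA -rowE -row_mul [RHS]mxE.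
  rewrite castE !rowi; congr ((D *m _) 0 0); apply/colP => k.
  have entry (u : 'cV[R]_n) : (rowsub f MR *m u) k 0 = (MR *m u) (f k) 0.
    rewrite mxE [RHS]mxE; apply: eq_bigr => j _.
    by rewrite [rowsub f MR k j]mxE.
  rewrite !entry -castE row_f ratr_int; apply/esym/eqP; exact: f_tight.
have feas : lp_feasible z'.
  move=> i; have [le_i eq_i] := fy i; rewrite -row_y in le_i eq_i.
  split; first by rewrite -(ler_rat R) ratr_int.
  by move=> /eq_i; rewrite -ratr_int => /(fmorph_inj (ratr : {rmorphism rat -> R})).
exists z' => //; have := row_y o; rewrite !row_o rmorphN => /oppr_inj zy.
have zj_ge0 : 0 <= z' j0 0.
  by have [] := feas o; rewrite row_o ho oppr_le0.
pose K : int := \sum_k (if g k == j0 then zS k 0 else 0).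
have zjE : z' j0 0 * (\det S)%:~R = K%:~R.
  rewrite mxE mulr_suml /K [RHS]rmorph_sum; apply: eq_bigr => k _.
  by case: eqP => _; rewrite ?mul0r // divfK.
have ltK : `|K| < 1.
  have small' : z' j0 0 * (\prod_i wt i)%N%:R < 1.
    rewrite -(ltr_rat R) rmorphM rmorph_nat rmorph1 zy.
    by apply: le_lt_trans small; apply: ler_wpM2r.
  rewrite -(ltr_int rat) intr_norm -zjE normrM ger0_norm //.
  apply: le_lt_trans small'; apply: ler_wpM2l => //.
  by rewrite -intr_norm; move: le_detS; rewrite -(ler_int rat).
have K0 : K = 0 by apply/eqP; rewrite -normr_eq0; move: ltK; clear; lia.
by move/eqP: zjE; rewrite K0 mulf_eq0 (negPf detQ) orbF => /eqP.
Qed.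
End Rounding.

(** * Correctness of the reduction *)

Section Forward.
Variables (R : realType) (I : max_average).
Local Notation v := (annotate PStart (enc_max_average I)).
Local Notation E := (unit_level R I).
Variable x : 'I_(ma_vars I) -> \bar rat.
Hypothesis x_fin : forall i, x i != +oo%E.

Definition exp_value (a : \bar rat) : R :=
  if a is r%:E%E then level v (E * ratr r) else 0.

Definition exp_sol (k : nat) : R :=
  if insub k is Some i then exp_value (x i) else 0.

Lemma exp_solE i : exp_sol (i : 'I__) = exp_value (x i).
Proof. by rewrite /exp_sol valK. Qed.

Lemma unit_level_gt0 : 0 < E.
Proof. by rewrite exprn_gt0. Qed.

Lemma exp_value_ge0 a : 0 <= exp_value a.
Proof. by case: a => //= r; apply: pow2_ge0. Qed.

Lemma exp_value_le a b : a != +oo%E -> b != +oo%E -> (a <= b)%E ->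
  exp_value a <= exp_value b.
Proof.
case: a => [r| |] //; case: b => [s| |] // _ _; rewrite /= ?exp_value_ge0 //.
  by rewrite lee_fin ler_pow2 lerD2r ler_pM2l ?unit_level_gt0 // ler_rat.
by move=> _; apply: pow2_ge0.
Qed.

Lemma le_bigmaxe_witness (J : eqType) (s : seq J) (F : J -> \bar rat) r :
  (r%:E <= \big[maxe/-oo]_(i <- s) F i)%E -> exists2 a, a \in s & (r%:E <= F a)%E.
Proof.
elim: s => [|a s IH]; first by rewrite big_nil leeNy_eq.
rewrite big_cons le_max => /orP[le_a|/IH[b bs le_b]].
  by exists a; rewrite ?inE ?eqxx.
by exists b; rewrite // inE bs orbT.
Qed.

Lemma strong_sem_of_satisfies C : satisfies x C -> strong_sem I exp_sol C.
Proof.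
case: C => [x0 xs|x0 x1 x2|x0 c] /=.
- rewrite exp_solE => le_max.
  have sum_ge0 : 0 <= \sum_(i <- xs) exp_sol i.
    by apply: sumr_ge0 => i _; rewrite exp_solE exp_value_ge0.
  move: le_max; case def_x0: (x x0) (x_fin x0) => [r| |] // _ le_r.
  have [a a_in le_a] := le_bigmaxe_witness le_r.
  apply: (@le_trans _ _ (exp_sol a)); first by rewrite exp_solE exp_value_le.
  rewrite (big_rem a) //= lerDl.
  by apply: sumr_ge0 => i _; rewrite exp_solE exp_value_ge0.
- rewrite !exp_solE => le_avg; split; rewrite ?exp_value_ge0 //.
  move: le_avg (x_fin x0) (x_fin x1) (x_fin x2).
  have zero : exp_value -oo%E ^+ 2 <= exp_value (x x1) * exp_value (x x2).
    by rewrite /= expr0n mulr_ge0 ?exp_value_ge0.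
  case: (x x0) zero => [r| |] // zero; case: (x x1) {zero} => [s| |] //;
    case: (x x2) => [t| |] //;
    rewrite ?mulNyr ?gtr0_sg ?mul1e // => le_avg _ _ _.
  + move: le_avg; rewrite -EFinD -EFinM lee_fin => le_avg.
    rewrite expr2 -!pow2D ler_pow2.
    have : (ratr r : R) <= (ratr s + ratr t) * 2^-1.
      by move: le_avg; rewrite -(ler_rat R) rmorphM rmorphD fmorphV rmorph_nat.
    have := unit_level_gt0; move: E (ratr r) (ratr s) (ratr t) => e r' s' t'.
    by move=> *; nra.
- rewrite exp_solE => ->; exists (E * ratr c); split=> //.
  rewrite /denom /numer /ratr; field.
  by rewrite intr_eq0 denq_neq0.
Qed.

Lemma feasible_of_solution : foldr and True [seq satisfies x C | C <- ma_constraints I] ->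
  sdp_feasible R (reduction I).
Proof.
move=> sat; apply: (@reduction_intro _ _ exp_sol).
elim: (ma_constraints I) sat => //= C cs IH [satC /IH sat]; split=> //.
exact: strong_sem_of_satisfies.
Qed.
End Forward.

Section Weights.
Variable n : nat.
Implicit Type C : constraint n.

(** Bounds the l1 norm of the row of the constraint. *)
Definition row_weight C : nat :=
  match C with LeMax _ _ => 3 | LeAverage _ _ _ => 4 | EqConst _ c => `|denq c| end.

(** Exceeds by 1 an estimate of the error, in multiples of 1/E, due to the
    replacement of a maximum of k entries by a sum: log2 k <= k. *)
Definition slack_weight C : nat :=
  match C with LeMax _ xs => (size xs).+1 | _ => 1 end.

Lemma row_weight_gt0 C : (0 < row_weight C)%N.
Proof. by case: C => //= _ c; rewrite absz_gt0 denq_neq0. Qed.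

Lemma slack_weight_gt0 C : (0 < slack_weight C)%N.
Proof. by case: C. Qed.

Lemma size_enc_ords (xs : seq 'I_n) :
  ((size xs).*2 < size (enc_seq (@enc_ord n) xs))%N.
Proof.
elim: xs => [//|y xs IH]; rewrite -[enc_seq _ _]cats0 enc_seq_cons cats0.
rewrite [size (y :: _)]/= [size (true :: _)]/= size_cat doubleS.
rewrite {1}/enc_ord /enc_unary size_rcons.
by move: IH; clear; lia.
Qed.

Lemma weight_le_size C :
  ((slack_weight C * row_weight C) ^ 2 <= 2 ^ (size (enc_constraint C)).+1)%N.
Proof.
have ord_gt0 (i : 'I_n) : (0 < size (enc_ord i))%N.
  by rewrite /enc_ord /enc_unary size_rcons.
case: C => [x0 xs|x0 x1 x2|x0 c].
- have le_pow k : ((k.+1 * 3) ^ 2 <= 2 ^ (k.*2 + 4))%N.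
    elim: k => // k; rewrite doubleS !addSn !expnS; nia.
  apply: leq_trans (le_pow (size xs)) _; rewrite leq_exp2l // /enc_constraint 2!size_cat.
  have := size_enc_ords xs; have := ord_gt0 x0; rewrite [size [:: _]]/=; clear; lia.
- rewrite /enc_constraint !size_cat; move: (ord_gt0 x0) (ord_gt0 x1) (ord_gt0 x2).
  move=> g0 g1 g2; apply: (@leq_trans (2 ^ 4)%N) => //; rewrite leq_exp2l //=.
  by move: g0 g1 g2; clear; lia.
- rewrite /= mul1n; set bs := bits_of_nat `|denq c|%N.
  have lt_q : (`|denq c| < 2 ^ size bs)%N by rewrite -{1}(bits_of_natK `|denq c|) lt_bits_value.
  apply: (@leq_trans ((2 ^ size bs) ^ 2)%N); first by rewrite leq_sqr ltnW.
  rewrite -expnM leq_exp2l //.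
  have -> : size (enc_ord x0 ++ enc_rat c) =
    (size (enc_ord x0) + (size (enc_int (numq c)) + (size bs).*2.+1))%N.
    by rewrite /enc_rat /enc_nat 2!size_cat size_enc_bits.
  by clear; lia.
Qed.
End Weights.

Lemma foldr_and_tnth (A : Type) (P : A -> Prop) (s : seq A) :
  (forall k, P (tnth (in_tuple s) k)) -> foldr and True [seq P a | a <- s].
Proof.
elim: s => // a s IH h; split; first by have := h ord0; rewrite (tnth_nth a).
by apply: IH => k; have := h (lift ord0 k); rewrite !(tnth_nth a).
Qed.

Section Backward.
Variables (R : realType) (I : max_average) (X : nat -> R).
Local Notation n := (ma_vars I).
Local Notation cs := (ma_constraints I).
Local Notation v := (annotate PStart (enc_max_average I)).
Local Notation T := (top_level R v).
Local Notation E := (unit_level R I).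
Hypothesis sem : foldr and True [seq weak_sem I X C | C <- cs].

Let cstr (k : 'I_(size cs)) : constraint n := tnth (in_tuple cs) k.

Lemma semC k : weak_sem I X (cstr k).
Proof.
rewrite /cstr (tnth_nth (cstr k)) /=; have := ltn_ord k; move: (nat_of_ord k) (cstr k).
elim: cs sem => //= C cs' IH [sC /IH{}IH] [|k'] C0 //= lt_k; exact: IH.
Qed.

Definition total_slack : nat := \prod_k slack_weight (cstr k).
Definition total_weight : nat := \prod_k row_weight (cstr k).

Lemma total_bound : (total_slack * total_weight)%N%:R <= E.
Proof.
have sq_le : ((total_slack * total_weight) ^ 2 <=
    2 ^ \sum_k (size (enc_constraint (cstr k))).+1)%N.
  rewrite /total_slack /total_weight -big_split /=.
  elim/big_rec2: _ => // k b a _ le_ab.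
  by rewrite expnMn expnD leq_mul // weight_le_size.
have size_sum : (\sum_k (size (enc_constraint (cstr k))).+1 + 2 <= size v)%N.
  have -> : (\sum_k (size (enc_constraint (cstr k))).+1 =
      \sum_(C <- cs) (size (enc_constraint C)).+1)%N.
    by rewrite [in RHS](big_tnth _ _ (in_tuple cs)).
  rewrite size_instance /enc_max_average size_cat.
  have -> : size (enc_seq (@enc_constraint n) cs) =
      (\sum_(C <- cs) (size (enc_constraint C)).+1).+1.
    elim: cs => [|C cs' IH]; first by rewrite big_nil.
    rewrite -[enc_seq _ _]cats0 enc_seq_cons cats0 /= size_cat IH big_cons.
    by clear; lia.
  by rewrite /enc_unary size_rcons; clear; lia.
rewrite /unit_level -natrX ler_nat -(@leq_sqr _ (_ ^ _)) -expnM.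
apply: leq_trans sq_le _; rewrite leq_exp2l //.
by move: size_sum; clear; lia.
Qed.

Definition pos_var (j : 'I_n) : bool := 0 < X j.

Definition lg (y : R) : R := ln y / ln 2.

Lemma pow2_lg y : 0 < y -> pow2 (lg y) = y.
Proof.
move=> y_gt0; rewrite /pow2 /lg divfK ?lnK ?posrE //.
by rewrite gt_eqF // ln2_gt0.
Qed.

Definition log_sol (j : 'I_n) : R := (lg (X j) + T) / E.

(** The entry of a maximum that will be required to dominate the left-hand
    side; by averaging, one entry carries at least its share of the sum. *)
Definition witness (x0 : 'I_n) (xs : seq 'I_n) : option 'I_n :=
  [pick a | (a \in xs) && (X x0 <= (size xs)%:R * X a)].

Lemma witness_exists (x0 : 'I_n) (xs : seq 'I_n) :
  0 < X x0 -> X x0 <= \sum_(a <- xs) X a -> witness x0 xs != None.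
Proof.
move=> X0_gt0 le_sum; rewrite /witness; case: pickP => // no.
have lt a : a \in xs -> (size xs)%:R * X a < X x0.
  by move=> a_in; have := no a; rewrite a_in ltNge => /negbT.
have [xs0|xs_gt0] := posnP (size xs).
  by move: le_sum; rewrite (size0nil xs0) big_nil leNgt X0_gt0.
have : (size xs)%:R * X x0 < \sum_(a <- xs) X x0.
  apply: (@le_lt_trans _ _ (\sum_(a <- xs) (size xs)%:R * X a)).
    by rewrite -mulr_sumr ler_wpM2l.
  case: (xs) xs_gt0 lt => // a s _ lt; rewrite !big_cons ltr_leD ?lt ?inE ?eqxx //.
  by rewrite !big_seq; apply: ler_sum => i i_in; rewrite ltW // lt // inE i_in orbT.
by rewrite big_const_seq count_predT iter_addr_0 mulr_natl ltxx.
Qed.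

Definition var_coef (a : 'I_n) (j : 'I_n.+1) : int := (j == lift ord0 a)%:R.
Definition slack_coef (j : 'I_n.+1) : int := (j == ord0)%:R.

Definition lhs_var (C : constraint n) : 'I_n :=
  match C with LeMax x0 _ => x0 | LeAverage x0 _ _ => x0 | EqConst x0 _ => x0 end.

(** Column 0 is for the error. A constraint whose left-hand side is -oo holds
    trivially and leaves a zero row. *)
Definition row_of (C : constraint n) (j : 'I_n.+1) : int :=
  if ~~ pos_var (lhs_var C) then 0 else
  match C with
  | LeMax x0 xs =>
      if witness x0 xs is Some a
      then var_coef x0 j - var_coef a j - slack_coef j else 0
  | LeAverage x0 x1 x2 => var_coef x0 j *+ 2 - var_coef x1 j - var_coef x2 j
  | EqConst x0 c => denq c * var_coef x0 j
  end.

Definition rhs_of (C : constraint n) : int :=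
  if C is EqConst x0 c then (if pos_var x0 then numq c else 0) else 0.

Definition eq_of (C : constraint n) : bool := if C is EqConst _ _ then true else false.

Lemma sum_delta (a : 'I_n.+1) : \sum_j `|(j == a)%:R : int| = 1.
Proof.
rewrite (bigD1 a) //= eqxx normr1 big1 ?addr0 // => j /negPf->.
by rewrite normr0.
Qed.

Lemma row_of_norm C : \sum_j `|row_of C j| <= (row_weight C)%:Z.
Proof.
rewrite /row_of; case: (pos_var (lhs_var C)) => /=; last first.
  by rewrite big1 // => j _; rewrite normr0.
case: C => [x0 xs|x0 x1 x2|x0 c] /=.
- case: (witness x0 xs) => [a|]; last by rewrite big1 // => j _; rewrite normr0.
  apply: (@le_trans _ _ (\sum_j (`|var_coef x0 j| + `|var_coef a j| + `|slack_coef j|))).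
    apply: ler_sum => j _; apply: le_trans (ler_normB _ _) _.
    by rewrite lerD2r; apply: ler_normB.
  by rewrite !big_split /= !sum_delta.
- apply: (@le_trans _ _ (\sum_j (`|var_coef x0 j| *+ 2 + `|var_coef x1 j| + `|var_coef x2 j|))).
    apply: ler_sum => j _; apply: le_trans (ler_normB _ _) _.
    by rewrite lerD2r; apply: le_trans (ler_normB _ _) _; rewrite lerD2r normrMn.
  by rewrite !big_split /= !sum_delta.
- under eq_bigr do rewrite normrM.
  by rewrite -mulr_sumr sum_delta mulr1 abszE.
Qed.

Definition dot (F : numDomainType) (r : 'I_n.+1 -> int) (z : 'cV[F]_n.+1) : F :=
  \sum_j (r j)%:~R * z j 0.

Lemma dot_delta (F : numDomainType) a (z : 'cV[F]_n.+1) :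
  dot (fun j => (j == a)%:R) z = z a 0.
Proof.
rewrite /dot (bigD1 a) //= eqxx rmorph1 mul1r big1 ?addr0 // => j /negPf->.
by rewrite rmorph0 mul0r.
Qed.

Definition row_value (F : numDomainType) (C : constraint n) (z : 'cV[F]_n.+1) : F :=
  let z_ a := z (lift ord0 a) 0 in
  if ~~ pos_var (lhs_var C) then 0 else
  match C with
  | LeMax x0 xs =>
      if witness x0 xs is Some a then z_ x0 - z_ a - z ord0 0 else 0
  | LeAverage x0 x1 x2 => z_ x0 *+ 2 - z_ x1 - z_ x2
  | EqConst x0 c => (denq c)%:~R * z_ x0
  end.

Lemma dot_row (F : numDomainType) C (z : 'cV[F]_n.+1) :
  dot (row_of C) z = row_value C z.
Proof.
have zero : \sum_j (0 : int)%:~R * z j 0 = 0 :> F.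
  by rewrite big1 // => j _; rewrite rmorph0 mul0r.
rewrite /dot /row_of /row_value; case: (pos_var (lhs_var C)) => //=.
case: C => [x0 xs|x0 x1 x2|x0 c].
- case: (witness x0 xs) => [a|] //; under eq_bigr do rewrite 2!rmorphB 2!mulrBl.
  by rewrite 2!sumrB; congr (_ - _ - _); apply: dot_delta.
- under eq_bigr do rewrite 2!rmorphB rmorphMn 2!mulrBl mulrnAl.
  by rewrite 2!sumrB sumrMnl; congr (_ *+ 2 - _ - _); apply: dot_delta.
- under eq_bigr do rewrite rmorphM -mulrA.
  by rewrite -mulr_sumr; congr (_ * _); apply: dot_delta.
Qed.

Definition lp_matrix : 'M[int]_((size cs).+1, n.+1) :=
  \matrix_(i, j) if unlift ord0 i is Some k then row_of (cstr k) j
                 else - (j == ord0)%:R.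
Definition lp_rhs : 'cV[int]_((size cs).+1) :=
  \col_i if unlift ord0 i is Some k then rhs_of (cstr k) else 0.
Definition lp_eq (i : 'I_(size cs).+1) : bool :=
  if unlift ord0 i is Some k then eq_of (cstr k) else false.
Definition lp_weight (i : 'I_(size cs).+1) : nat :=
  if unlift ord0 i is Some k then row_weight (cstr k) else 1.

Lemma lp_row (F : numDomainType) k (z : 'cV[F]_n.+1) :
  (map_mx intr lp_matrix *m z) (lift ord0 k) 0 = row_value (cstr k) z.
Proof.
rewrite -dot_row mxE; apply: eq_bigr => j _.
by rewrite [map_mx _ _ _ _]mxE [lp_matrix _ _]mxE liftK.
Qed.

Lemma lp_row0 (F : numDomainType) (z : 'cV[F]_n.+1) :
  (map_mx intr lp_matrix *m z) ord0 0 = - z ord0 0.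
Proof.
rewrite (@row_o _ _ lp_matrix ord0 ord0) // => j.
by rewrite mxE unlift_none.
Qed.

(** The logarithmic form of the constraints. In an average, positivity of the
    left-hand side forces that of both entries. *)
Lemma weak_sem_value C : weak_sem I X C -> pos_var (lhs_var C) ->
  match C with
  | LeMax x0 xs => exists2 a, witness x0 xs = Some a &
      [/\ a \in xs, pos_var a & log_sol x0 <= log_sol a + (size xs)%:R / E]
  | LeAverage x0 x1 x2 => [/\ pos_var x1, pos_var x2 &
      log_sol x0 *+ 2 <= log_sol x1 + log_sol x2]
  | EqConst x0 c => denom R c * log_sol x0 = numer R c
  end.
Proof.
have E_gt0 := unit_level_gt0 R I.
rewrite /pos_var /log_sol; case: C => [x0 xs|x0 x1 x2|x0 c] /= semC X0_gt0.
- have := witness_exists X0_gt0 semC; rewrite /witness; case: pickP => // a.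
  move=> /andP[a_in le_a] _; exists a => //.
  have Xa_gt0 : 0 < X a.
    by have := lt_le_trans X0_gt0 le_a; rewrite pmulr_rgt0 // ltr0n; case: (xs) a_in.
  split=> //; rewrite -mulrDl ler_pM2r ?invr_gt0 // addrAC lerD2r.
  rewrite -ler_pow2 pow2D !pow2_lg // mulrC; apply: le_trans le_a _.
  rewrite ler_pM2r // pow2_nat -natrX ler_nat.
  exact: ltnW (ltn_expl _ _).
- case: semC => a [r [le0 le1 r_ge0 x2_ge0 sq]].
  have a_gt0 := lt_le_trans X0_gt0 le0.
  have rx_gt0 : 0 < r * X x2 by apply: lt_le_trans sq; rewrite exprn_gt0.
  have r_gt0 : 0 < r.
    rewrite lt_neqAle r_ge0 andbT eq_sym; apply: contraL rx_gt0 => /eqP->.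
    by rewrite mul0r ltxx.
  have x2_gt0 : 0 < X x2 by rewrite pmulr_rgt0 in rx_gt0.
  have x1_gt0 := lt_le_trans r_gt0 le1.
  split=> //; rewrite -mulrnAl -mulrDl ler_pM2r ?invr_gt0 //.
  suff : lg (X x0) *+ 2 <= lg (X x1) + lg (X x2) by lra.
  rewrite -ler_pow2 mulr2n !pow2D !pow2_lg // -expr2.
  apply: (@le_trans _ _ (a ^+ 2)).
    by rewrite ler_pXn2r ?nnegrE ?(ltW X0_gt0) ?(ltW a_gt0).
  by apply: le_trans sq _; rewrite ler_pM2r.
- case: semC => xi [def_x def_xi]; rewrite def_x /level.
  have -> : lg (pow2 (xi - T)) = xi - T.
    by rewrite /lg /pow2 expRK mulfK // gt_eqF // ln2_gt0.
  by rewrite subrK mulrA def_xi mulfK // gt_eqF.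
Qed.

Definition real_point : 'cV[R]_n.+1 :=
  \col_i if unlift ord0 i is Some j then (if pos_var j then log_sol j else 0)
         else (total_slack.-1)%:R / E.

Lemma real_point_feasible : lp_feasible lp_matrix lp_rhs lp_eq real_point.
Proof.
have E_gt0 := unit_level_gt0 R I.
have z0 : real_point ord0 0 = (total_slack.-1)%:R / E by rewrite mxE unlift_none.
have zj j : real_point (lift ord0 j) 0 = if pos_var j then log_sol j else 0.
  by rewrite mxE liftK.
move=> i; case: (unliftP ord0 i) => [k|] ->; last first.
  rewrite lp_row0 z0 /lp_eq unlift_none [lp_rhs _ _]mxE unlift_none; split=> //.
  by rewrite rmorph0 oppr_le0 divr_ge0 // ltW.
rewrite lp_row /lp_eq liftK [lp_rhs _ _]mxE liftK /row_value /rhs_of.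
case: ifPn => [npos|/negbNE pos].
  case: (cstr k) npos => [x0 xs|x0 x1 x2|x0 c] //= /negPf npos.
  by rewrite npos; split.
have slack_le : (slack_weight (cstr k) <= total_slack)%N.
  rewrite /total_slack (bigD1 k) //= leq_pmulr //.
  by rewrite prodn_gt0 // => l; apply: slack_weight_gt0.
have := weak_sem_value (semC k) pos.
case: (cstr k) pos slack_le => [x0 xs|x0 x1 x2|x0 c] /= pos slack_le; rewrite ?zj ?pos.
- case=> a -> [a_in pos_a le_a]; rewrite ?zj ?pos pos_a z0; split=> //.
  rewrite rmorph0 -addrA -opprD subr_le0; apply: le_trans le_a _.
  rewrite lerD2l ler_pM2r ?invr_gt0 // ler_nat.
  by move: slack_le; clear; case: total_slack.
- case=> pos1 pos2 le_avg; rewrite ?zj ?pos pos1 pos2; split=> //.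
  by rewrite rmorph0; lra.
- by move=> eq_c; rewrite -/(denom R c) eq_c.
Qed.

Lemma rational_point : exists2 z : 'cV[rat]_n.+1,
  lp_feasible lp_matrix lp_rhs lp_eq z & z ord0 0 = 0.
Proof.
have E_gt0 := unit_level_gt0 R I.
apply: (@lp_rounding R _ _ _ _ _ ord0 ord0 _ _ lp_weight _ _ real_point).
- by move=> j; rewrite mxE unlift_none.
- by rewrite mxE unlift_none.
- move=> i; rewrite /lp_weight; case: unlift => // k; exact: row_weight_gt0.
- move=> i; case: (unliftP ord0 i) => [k|] ->.
    rewrite /lp_weight liftK; apply: le_trans (row_of_norm (cstr k)).
    by apply: ler_sum => j _; rewrite mxE liftK.
  rewrite /lp_weight unlift_none.
  apply: (@le_trans _ _ (\sum_j `|(j == ord0 :> 'I_n.+1)%:R : int|)); last first.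
    by rewrite sum_delta.
  by apply: ler_sum => j _; rewrite mxE unlift_none normrN.
- exact: real_point_feasible.
rewrite mxE unlift_none.
have -> : (\prod_i lp_weight i = total_weight)%N.
  rewrite big_ord_recl {1}/lp_weight unlift_none mul1n.
  by apply: eq_bigr => k _; rewrite /lp_weight liftK.
rewrite mulrAC ltr_pdivrMr // mul1r; apply: lt_le_trans total_bound.
rewrite -natrM ltr_nat ltn_pmul2r.
  have : (0 < total_slack)%N by rewrite prodn_gt0 // => k; apply: slack_weight_gt0.
  by clear; case: total_slack.
by rewrite prodn_gt0 // => k; apply: row_weight_gt0.
Qed.

Lemma le_bigmaxe (J : eqType) (s : seq J) (F : J -> \bar rat) a :
  a \in s -> (F a <= \big[maxe/-oo]_(i <- s) F i)%E.
Proof.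
elim: s => // b s IH; rewrite inE big_cons le_max => /predU1P[->|/IH->].
  by rewrite lexx.
by rewrite orbT.
Qed.

Lemma solvable_of_weak_sem : ma_solvable I.
Proof.
have [z fz z0] := rational_point.
pose x j : \bar rat := if pos_var j then (z (lift ord0 j) 0)%:E%E else -oo%E.
exists x; split; first by move=> j; rewrite /x; case: ifP.
apply: foldr_and_tnth => k; rewrite -/(cstr k).
have /= := fz (lift ord0 k); rewrite lp_row /lp_eq liftK [lp_rhs _ _]mxE liftK.
rewrite /row_value /rhs_of z0.
have := weak_sem_value (semC k); have := semC k.
case: (cstr k) => [x0 xs|x0 x1 x2|x0 c] /=.
- move=> _; case: (boolP (pos_var x0)) => [pos|npos] /=; last first.
    by rewrite /x (negPf npos) => _ _; apply: leNye.
  case/(_ isT) => a -> [a_in pos_a _] [le_a _].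
  apply: le_trans (le_bigmaxe x a_in); rewrite /x pos pos_a lee_fin.
  by move: le_a; rewrite rmorph0 subr0 subr_le0.
- move=> _; case: (boolP (pos_var x0)) => [pos|npos] /=; last first.
    by rewrite /x (negPf npos) => _ _; apply: leNye.
  case/(_ isT) => pos1 pos2 _ [le_avg _]; rewrite /x pos pos1 pos2.
  rewrite -EFinD -EFinM lee_fin; move: le_avg; rewrite rmorph0; lra.
- case=> xi [def_x _]; have pos : pos_var x0.
    by rewrite /pos_var def_x pow2_gt0.
  rewrite pos /= => _ [_ /(_ isT) eq_c]; rewrite /x pos; congr (_%:E)%E.
  rewrite -[RHS]divq_num_den -eq_c mulrC mulKf //.
  by rewrite intr_eq0 denq_neq0.
Qed.
End Backward.

Theorem corollary10 (R : realType) :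
  polytime_reducible max_average_csp (sdp_feasibility R).
Proof.
exists reduction; split; first exact: reduction_polytime.
move=> I; split=> [[x [x_fin sat]]|/reduction_elim[X sem]].
  exact: feasible_of_solution sat.
exact: solvable_of_weak_sem sem.
Qed.
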